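(* Let $\kappa\in(0,1)$ and let $0<r<r^*(\kappa)$, where $r^*(\kappa)$ is the threshold defined in the context. Then there exist constants $C,c>0$, depending only on $\kappa$ and $r$, such that for all positive integers $m$ for which $p:=\kappa m$ and $S:=rm$ are integers, the following holds with $n:=m-p$. If $A$ is an $m\times n$ random matrix with i.i.d. Gaussian entries of mean zero and common positive variance, then with probability at least $1-Ce^{-cm}$, for every $f\in\mathbf{R}^n$ and every $e\in\mathbf{R}^m$ with at most $S$ nonzero entries, setting $y=Af+e$, the solution to $$\min_{g\in\mathbf{R}^n}\ \|y-Ag\|_{\ell_1}$$ is unique and equal to $f$. In particular, this conclusion holds for all $0<r\le3.6\cdot10^{-4}$ when $\kappa=3/4$, for all $0<r\le3.2\cdot10^{-4}$ when $\kappa=2/3$, and for all $0<r\le2.3\cdot10^{-4}$ when $\kappa=1/2$.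
   Context: Here $\|x\|_{\ell_1}=\sum_i|x_i|$. Threshold: let $H(q):=-q\log q-(1-q)\log(1-q)$ for $0<q<1$ (natural logarithm). For $\kappa\in(0,1]$ and $0<q<1$ let $f_\kappa(q):=\kappa^{-1/2}\left(\sqrt q+\sqrt{2H(q)}\right)$. For $0<r<1/3$ let $\rho_\kappa(r):=\sum_{j=1}^3\left(-1+[1+f_\kappa(jr)]^2\right)$. Define $r^*(\kappa):=\sup\{r\in(0,1/3):\rho_\kappa(r')<1\text{ for all }r'\in(0,r)\}$. *)

(* Defs.v *)
From HB Require Import structures.
From mathcomp Require Import all_boot all_order all_algebra.
From mathcomp Require Import all_classical all_reals all_analysis.

Set Implicit Arguments.
Unset Strict Implicit.
Unset Printing Implicit Defensive.

Import Order.TTheory GRing.Theory Num.Theory.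
Import numFieldNormedType.Exports.

Local Open Scope classical_set_scope.
Local Open Scope ring_scope.

Definition entropy (R : realType) (q : R) : R :=
  - q * ln q - (1 - q) * ln (1 - q).

Definition fkappa (R : realType) (kappa q : R) : R :=
  (Num.sqrt kappa)^-1 * (Num.sqrt q + Num.sqrt (2 * entropy q)).

Definition rho (R : realType) (kappa r : R) : R :=
  \sum_(1 <= j < 4) (- 1 + (1 + fkappa kappa (j%:R * r)) ^+ 2).

(* For 0 < kappa <= 1 this set is nonempty (rho kappa r tends to 0 as r -> 0+)
   and bounded by 1/3, so that sup is not at its default value. *)
Definition rstar (R : realType) (kappa : R) : R :=
  sup [set r : R | 0 < r < 1 / 3 /\
                   forall r', 0 < r' < r -> rho kappa r' < 1].

(* The norm provided by the library on matrices is the sup norm. *)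
Definition l1norm (R : realType) (m : nat) (x : 'cV[R]_m) : R :=
  \sum_(i < m) `|x i 0|.

Definition l1_minimizers (R : realType) (m n : nat)
    (A : 'M[R]_(m, n)) (y : 'cV[R]_m) : set 'cV[R]_n :=
  [set g | forall h : 'cV[R]_n, l1norm (y - A *m g) <= l1norm (y - A *m h)].

Definition exact_recovery (R : realType) (m n S : nat) (A : 'M[R]_(m, n)) :
    Prop :=
  forall (f : 'cV[R]_n) (e : 'cV[R]_m),
    (#|[pred i | e i 0%R != 0%R]| <= S)%N ->
    l1_minimizers A (A *m f + e) = [set f].

Definition mutual_independence (R : realType) (d : measure_display)
    (T : measurableType d) (P : probability T R) (I : finType)
    (X : I -> {RV P >-> R}) : Prop :=
  forall (J : {set I}) (B : I -> set R),
    (forall i, measurable (B i)) ->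
    P (\bigcap_(i in [set` J]) (X i @^-1` B i)) =
    (\prod_(i in J) P (X i @^-1` B i))%E.

Arguments mutual_independence [R d T] P [I] X.

(* The second parameter of normal_prob is the standard deviation. *)
Definition iid_centered_gaussian (R : realType) (d : measure_display)
    (T : measurableType d) (P : probability T R) (I : finType)
    (X : I -> {RV P >-> R}) : Prop :=
  mutual_independence P X /\
  exists2 sigma : R, 0 < sigma &
    forall (i : I) (V : set R), measurable V ->
      distribution P (X i) V = normal_prob 0 sigma V.

Arguments iid_centered_gaussian [R d T] P [I] X.

Definition random_matrix (R : realType) (d : measure_display)
    (T : measurableType d) (P : probability T R) (m n : nat)
    (A : 'I_m * 'I_n -> {RV P >-> R}) (t : T) : 'M[R]_(m, n) :=
  \matrix_(i, j) A (i, j) t.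

Arguments random_matrix [R d T] P [m n] A t.

(* P is only meaningful on measurable sets, hence the first conjunct. *)
Definition with_probability_at_least (R : realType) (d : measure_display)
    (T : measurableType d) (P : probability T R) (q : R) (E : set T) : Prop :=
  measurable E /\ (q%:E <= P E)%E.

(* The hypotheses force p < m when kappa < 1, so m - p is not truncated. *)
Definition recovery_with_overwhelming_probability (R : realType)
    (kappa r : R) : Prop :=
  exists C c : R, [/\ 0 < C, 0 < c &
    forall m p S : nat, (0 < m)%N -> p%:R = kappa * m%:R -> S%:R = r * m%:R ->
    let n := (m - p)%N in
    forall (d : measure_display) (T : measurableType d) (P : probability T R)
      (A : 'I_m * 'I_n -> {RV P >-> R}),
      iid_centered_gaussian P A ->
      with_probability_at_least P (1 - C * expR (- c * m%:R))
        [set t | exact_recovery S (random_matrix P A t)]].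

(* Main.v *)
Require Import Defs.
From mathcomp Require Import all_boot all_order all_algebra.
From mathcomp Require Import all_classical all_reals all_analysis.
From mathcomp Require Import measurable_realfun.
From mathcomp Require Import ring lra.
Set Implicit Arguments. Unset Strict Implicit. Unset Printing Implicit Defensive.
Import Order.TTheory GRing.Theory Num.Theory.
Import numFieldNormedType.Exports.
Local Open Scope classical_set_scope.
Local Open Scope ring_scope.

(**
Exact recovery of every [S]-sparse corruption is a property of the range of
[A] alone: it holds if and only if every nonzero vector [z] of the range has
less l1 mass on each set of [S] coordinates than off it (the null space
property [nsp]).  The range is random of dimension [n] in dimension [m = n + p],
and [residual A], the orthogonal projection along it, kills exactly its
vectors.

Suppose that [residual A] multiplies the norm of every [17 * S]-sparse vector by a
factor between [lo] and [hi], where [hi < 4 * lo].  Then [nsp] holds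
([nsp_of_rip]).  Indeed, let [z] be in the range, with at least half its l1 mass on
a set [T] of [S] coordinates.  Off [T], separate the [16 * S] largest entries
from the others; cutting the others into blocks of [16 * S] entries of decreasing
size shows that their projection has norm at most a quarter of [hi] times the
norm of [z] on [T] ([block_decomposition]).  The projections of the two pieces
of [z] cancel, while the first piece, being sparse, has a projection of norm at
least [lo] times its own; so [z = 0].

For one fixed vector [x], the ratio of the squared norms of [residual A *m x] and
[x] concentrates around [kappa = p / m]: outside of the interval from
[2 / 5 * kappa] to [2 * kappa] it falls with probability at most
[expR (- (7 / 50) * p)] on each side.  Gaussian matrices are rotation invariant, so
that the probability is the same for all nonzero [x]; one may hence replace [x] by an
independent Gaussian vector and, exchanging the integrals, fix [A] instead
([tail_fixed_vector]).  After a rotation that makes the range a coordinate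
subspace, the event becomes a comparison of two independent chi-square variables,
to which the exponential Markov inequality applies ([chernoff_excess]).

A union bound over the integer vectors with at most [k = 17 * S] nonzero
coordinates and l1 norm at most [10 * k] extends this to all sparse vectors, since
these points, suitably scaled, approximate every sparse unit vector up to a sparse
error of norm at most one tenth ([net_approx], [rip_of_net]).  There are at most
[(net_base / (17 * r)) ^+ k] of them ([card_net]), so the failure probability decays
exponentially as soon as [17 * r * ln (net_base / (17 * r)) < 7 / 50 * kappa], which is
the condition [0 < decay_rate kappa r].

It remains to compare this condition with the threshold.  If [rho kappa r < 1],
then the three values of [fkappa] are small, so that [kappa] exceeds a large
multiple of [r * (1 + Num.sqrt (2 * ln (1 / (3 * r)))) ^+ 2]; this is ample for
[decay_rate] to be positive ([decay_rate_gt0_of_rho]).  The explicit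
values of [r] are treated by bounding [x * ln (a / x)] by its tangent
([decay_rate_gt0_of_le]).
*)

(** * Families of random variables and their laws *)

Section families.
Context {R : realType} {I : finType}.

Definition box (B : I -> set (measurableTypeR R)) : set (I -> R) :=
  [set x | forall i, B i (x i)].

Definition boxes : set (set (I -> R)) :=
  [set E | exists2 B, (forall i, measurable (B i)) & E = box B].

(** The product sigma-algebra on [I -> R], generated by the boxes. *)
Definition cyl := g_sigma_algebraType boxes.

Definition sample (T : Type) (X : I -> T -> R) : T -> cyl := fun t i => X i t.

Lemma boxes_setI : setI_closed boxes.
Proof.
move=> _ _ [B mB ->] [C mC ->]; exists (fun i => B i `&` C i).
  by move=> i; exact: measurableI.
apply/seteqP; split=> x /=.
  by move=> [xB xC] i; split; [exact: xB|exact: xC].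
by move=> xBC; split=> i; have [] := xBC i.
Qed.

Lemma boxes_setT : boxes setT.
Proof.
by exists (fun=> setT) => //; apply/seteqP; split.
Qed.

Lemma measurable_box B : (forall i, measurable (B i)) ->
  measurable (box B : set cyl).
Proof. by move=> mB; apply: sub_sigma_algebra; exists B. Qed.

Lemma measurable_coord i : measurable_fun [set: cyl] (fun x : cyl => x i : R).
Proof.
move=> _ B mB; rewrite setTI.
have -> : (fun x : cyl => x i : R) @^-1` B =
    box (fun j => if j == i then B else setT).
  apply/seteqP; split=> x /=.
    by move=> Bx j; case: eqP => // ->.
  by move/(_ i); rewrite eqxx.
by apply: measurable_box => j; case: ifP.
Qed.

Lemma preimage_boxE d (T : measurableType d) (X : I -> T -> R) B :
  sample X @^-1` box B = \bigcap_(i in [set: I]) X i @^-1` B i.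
Proof.
apply/seteqP; split=> t /=; first by move=> h i _; exact: h.
by move=> h i; exact: h.
Qed.

Lemma measurable_family d (T : measurableType d) (X : I -> T -> R) :
  (forall i, measurable_fun setT (X i)) ->
  measurable_fun setT (sample X).
Proof.
move=> mX; apply: (@measurability _ _ T cyl setT (sample X) boxes) => // _ [_ [B mB ->] <-].
rewrite setTI preimage_boxE.
apply: fin_bigcap_measurable; first exact: finite_finset.
move=> i _; rewrite -[X in measurable X]setTI; exact: (mX i measurableT (B i) (mB i)).
Qed.

(** Only the product rule for the full set [J] of indices is required: for a
    smaller set it is the special case where [B i] is the whole line for the other
    indices ([iid_onS]).  The members of [X] outside of [J] are unconstrained,
    which allows a family to be assembled from partial ones. *)
Definition iid_on (g : probability (measurableTypeR R) R) (J : {set I})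
    d (T : measurableType d) (P : {measure set T -> \bar R}) (X : I -> T -> R) :=
  (forall i, measurable_fun setT (X i)) /\
  forall B : I -> set (measurableTypeR R), (forall i, measurable (B i)) ->
    P [set t | forall i, i \in J -> B i (X i t)] = (\prod_(i in J) g (B i))%E.

Lemma iid_onS g (J K : {set I}) d (T : measurableType d)
    (P : {measure set T -> \bar R}) X :
  K \subset J -> iid_on g J P X -> iid_on g K P X.
Proof.
move=> KJs [mX PX]; split=> // B mB.
have KJ i : i \in K -> i \in J by move: i; exact/fintype.subsetP.
pose C i := if i \in K then B i else setT.
have mC i : measurable (C i) by rewrite /C; case: ifP.
have -> : [set t | forall i, i \in K -> B i (X i t)] =
          [set t | forall i, i \in J -> C i (X i t)].
  apply/seteqP; split=> t /= Ht i iJ.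
    by rewrite /C; case: ifP => // iK; exact: Ht.
  by have := Ht i (KJ i iJ); rewrite /C iJ.
rewrite (PX _ mC) (big_setID K) /= (finset.setIidPr KJs).
rewrite [X in (_ * X)%E]big1 ?mule1; last first.
  by move=> i; rewrite inE => /andP[/negbTE iK _]; rewrite /C iK probability_setT.
by apply: eq_bigr => i iK; rewrite /C iK.
Qed.

(** Independence and the common law determine the measures of boxes, and boxes form
    a pi-system that generates the sigma-algebra.  All later changes of probability
    space go through this lemma. *)
Lemma iid_law (g : probability (measurableTypeR R) R)
    d1 (T1 : measurableType d1) (P1 : {measure set T1 -> \bar R}) X1
    d2 (T2 : measurableType d2) (P2 : {measure set T2 -> \bar R}) X2 :
  iid_on g [set: I] P1 X1 -> iid_on g [set: I] P2 X2 ->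
  forall E : set cyl, measurable E ->
    pushforward P1 (sample X1) E =
    pushforward P2 (sample X2) E.
Proof.
move=> [mX1 PX1] [mX2 PX2] E mE.
have m1 := measurable_family mX1; have m2 := measurable_family mX2.
pose Q1 := measure_function_pushforward__canonical__measure_function_Measure P1 m1.
pose Q2 := measure_function_pushforward__canonical__measure_function_Measure P2 m2.
have Qbox B : (forall i, measurable (B i)) ->
    Q1 (box B) = (\prod_(i in [set: I]%SET) g (B i))%E /\
    Q2 (box B) = (\prod_(i in [set: I]%SET) g (B i))%E.
  move=> mB.
  have fullE (T : Type) (X : I -> T -> R) : sample X @^-1` box B =
      [set t | forall i, i \in [set: I]%SET -> B i (X i t)].
    by apply/seteqP; split=> t /= h i => [_|]; apply: h; rewrite ?inE.
  by rewrite /Q1 /Q2 /= /pushforward !fullE PX1// PX2.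
apply: (@measure_unique _ R cyl boxes (fun=> setT) erefl boxes_setI
  (fun=> boxes_setT) _ Q1 Q2 _ _ E mE).
- by rewrite bigcup_const//; exists 0%N.
- by move=> _ [B mB ->]; have [-> ->] := Qbox _ mB.
- move=> _; have [B mB ->] := boxes_setT.
  have [-> _] := Qbox _ mB.
  by rewrite ltey_eq prode_fin_num// => i _; exact: fin_num_measure.
Qed.

(** On the product of two probability spaces, the members with index in [J] are read
    on the first space and the others on the second.  Replacing part of an i.i.d.
    family by an independent copy in this way makes Fubini's theorem available. *)
Definition glue (J : {set I}) (T1 T2 : Type) (X1 : I -> T1 -> R)
    (X2 : I -> T2 -> R) (i : I) (t : T1 * T2) : R :=
  if i \in J then X1 i t.1 else X2 i t.2.

Lemma iid_on_glue (g : probability (measurableTypeR R) R) (J : {set I})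
    d1 (T1 : measurableType d1) (P1 : {measure set T1 -> \bar R}) X1
    d2 (T2 : measurableType d2) (P2 : {sigma_finite_measure set T2 -> \bar R}) X2 :
  iid_on g J P1 X1 -> iid_on g (~: J)%SET P2 X2 ->
  iid_on g [set: I]%SET (P1 \x P2)%E (glue J X1 X2).
Proof.
move=> [mX1 PX1] [mX2 PX2]; split=> [i|B mB].
  by rewrite /glue; case: (i \in J); apply: measurableT_comp.
have -> : [set t | forall i, i \in [set: I]%SET -> B i (glue J X1 X2 i t)] =
    [set t | forall i, i \in J -> B i (X1 i t)] `*`
    [set t | forall i, i \in (~: J)%SET -> B i (X2 i t)].
  apply/seteqP; split=> -[t1 t2] /=.
    move=> h; split=> i iJ; have := h i (finset.in_setT i); rewrite /glue /=.
      by rewrite iJ.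
    by move: iJ; rewrite finset.in_setC => /negbTE ->.
  move=> [h1 h2] i _; rewrite /glue /=; case: ifPn => iJ; first exact: h1.
  by apply: h2; rewrite finset.in_setC.
have mfin d (T : measurableType d) (X : I -> T -> R) (K : {set I}) :
    (forall i, measurable_fun setT (X i)) ->
    measurable [set t | forall i, i \in K -> B i (X i t)].
  move=> mX; have -> : [set t | forall i, i \in K -> B i (X i t)] =
      \bigcap_(i in [set` K]) X i @^-1` B i by [].
  apply: fin_bigcap_measurable; first exact: finite_finset.
  move=> i _; rewrite -[X in measurable X]setTI.
  exact: (mX i measurableT (B i) (mB i)).
apply: etrans; first by apply: product_measure1E; exact: mfin.
rewrite PX1// PX2// [RHS](big_setID J) /=.
congr (_ * _)%E; apply: eq_bigl => i.
  by rewrite finset.in_setI finset.in_setT.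
by rewrite finset.in_setD finset.in_setT finset.in_setC andbT.
Qed.

End families.
Arguments cyl R I : clear implicits.

(** * Invariance of the plane Gaussian measure under rotations *)

Section plane_rotation.
Context {R : realType}.
Local Notation mu := (@lebesgue_measure R).
Local Open Scope ereal_scope.

(** The measure obtained by translation agrees with Lebesgue measure on intervals,
    which characterizes it. *)
Lemma lebesgue_measure_shift (a : R) (A : set (measurableTypeR R)) :
  measurable A ->
  pushforward mu ((fun x => x + a)%R : measurableTypeR R -> measurableTypeR R) A
  = mu A.
Proof.
move=> mA.
have ms : measurable_fun [set: measurableTypeR R]
    ((fun x => x + a)%R : measurableTypeR R -> measurableTypeR R).
  exact: (@measurable_funD _ (measurableTypeR R)).
apply/esym/(@lebesgue_measure_unique _
  (measure_function_pushforward__canonical__measure_function_Measure mu ms)) => //.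
move=> /= _ [[b c]] _ <-.
rewrite /pushforward.
rewrite (_ : _ @^-1` _ = `](b - a)%R, (c - a)%R]%classic); last first.
  by apply/seteqP; split=> x /=; rewrite !in_itv /= ltrBlDr lerBrDr.
rewrite !lebesgue_measure_itv/= !lte_fin ltrD2r.
by case: ifP => // _; rewrite -!EFinD; congr EFin; ring.
Qed.

Lemma ge0_integral_shift (a : R) (f : R -> \bar R) :
  measurable_fun [set: measurableTypeR R] f -> (forall x, 0 <= f x) ->
  \int[mu]_x f (x + a)%R = \int[mu]_x f x.
Proof.
move=> mf f0.
have ms : measurable_fun [set: measurableTypeR R]
    ((fun x => x + a)%R : measurableTypeR R -> measurableTypeR R).
  exact: (@measurable_funD _ (measurableTypeR R)).
transitivity (\int[pushforward mu ((fun x => x + a)%R :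
    measurableTypeR R -> measurableTypeR R)]_x f x).
  by rewrite (ge0_integral_pushforward ms).
by apply: eq_measure_integral => A mA _; exact: lebesgue_measure_shift.
Qed.

(** The normal density is a Radon-Nikodym derivative of the normal law, by definition
    of the latter; change of variables is stated for the abstract derivative, with which
    the density agrees almost everywhere. *)
Lemma ge0_integral_normal (s : R) (f : R -> \bar R) :
  measurable_fun [set: measurableTypeR R] f -> (forall x, 0 <= f x) ->
  \int[normal_prob 0 s]_x f x = \int[mu]_x (f x * (normal_pdf 0 s x)%:E).
Proof.
move=> mf f0.
have dom : normal_prob 0 s `<< mu := normal_prob_dominates 0 s.
rewrite -(Radon_Nikodym_SigmaFinite.change_of_variables dom f0)//.
apply: ae_eq_integral => //.
- apply: emeasurable_funM => //.
  exact: measurable_int (Radon_Nikodym_SigmaFinite.f_integrable dom).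
- apply: emeasurable_funM => //; apply/measurable_EFinP.
  exact: measurable_normal_pdf.
- apply: ae_eqe_mul2l; apply: integral_ae_eq => //.
  + exact: Radon_Nikodym_SigmaFinite.f_integrable.
  + by apply/measurable_EFinP; exact: measurable_normal_pdf.
  + by move=> A _ mA; rewrite -Radon_Nikodym_SigmaFinite.f_integral.
Qed.

Let T2 := (measurableTypeR R * measurableTypeR R)%type.

Lemma integral_shear_fst (a : R) (F : T2 -> \bar R) :
  measurable_fun setT F -> (forall z, 0 <= F z) ->
  \int[mu]_x \int[mu]_y F (x + a * y, y)%R = \int[mu]_x \int[mu]_y F (x, y).
Proof.
move=> mF F0.
pose G (z : T2) := F (z.1 + a * z.2, z.2)%R.
have mG : measurable_fun setT G.
  apply: (measurableT_comp mF).
  apply/measurable_fun_pairP; split; last exact: measurable_snd.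
  apply: (@measurable_funD _ T2); first exact: measurable_fst.
  by apply: (@measurable_funM _ T2) => //; exact: measurable_snd.
have EG := @fubini_tonelli _ _ _ _ R mu mu G mG (fun z => F0 _).
have EF := @fubini_tonelli _ _ _ _ R mu mu F mF F0.
apply: (etrans EG); apply/esym; apply: (etrans EF); apply: eq_integral => y _.
rewrite -[LHS](ge0_integral_shift (a * y) (f := fun x => F (x, y)))//.
exact: measurableT_comp.
Qed.

Lemma integral_shear_snd (b : R) (F : T2 -> \bar R) :
  measurable_fun setT F -> (forall z, 0 <= F z) ->
  \int[mu]_x \int[mu]_y F (x, y + b * x)%R = \int[mu]_x \int[mu]_y F (x, y).
Proof.
move=> mF F0; apply: eq_integral => x _.
rewrite (ge0_integral_shift (b * x) (f := fun y => F (x, y)))//.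
exact: measurableT_comp.
Qed.

(** A rotation of the plane is a product of three shears, and a shear preserves
    the integral because, by Fubini's theorem, it acts as a translation on each line
    parallel to an axis.  This replaces the change of variables formula. *)
Lemma integral_rotation (c s : R) (F : T2 -> \bar R) :
  (c ^+ 2 + s ^+ 2 = 1)%R -> s != 0%R ->
  measurable_fun setT F -> (forall z, 0 <= F z) ->
  \int[mu]_x \int[mu]_y F (c * x - s * y, s * x + c * y)%R =
  \int[mu]_x \int[mu]_y F (x, y).
Proof.
move=> cs1 s0 mF F0; pose a := ((c - 1) / s)%R.
rewrite -[RHS](integral_shear_fst a mF F0).
pose F1 (z : T2) := F (z.1 + a * z.2, z.2)%R.
have mF1 : measurable_fun setT F1.
  apply: (measurableT_comp mF).
  apply/measurable_fun_pairP; split; last exact: measurable_snd.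
  apply: (@measurable_funD _ T2); first exact: measurable_fst.
  by apply: (@measurable_funM _ T2) => //; exact: measurable_snd.
rewrite -[RHS](integral_shear_snd s mF1 (fun z => F0 _)).
pose F2 (z : T2) := F1 (z.1, z.2 + s * z.1)%R.
have mF2 : measurable_fun setT F2.
  apply: (measurableT_comp mF1).
  apply/measurable_fun_pairP; split; first exact: measurable_fst.
  apply: (@measurable_funD _ T2); first exact: measurable_snd.
  by apply: (@measurable_funM _ T2) => //; exact: measurable_fst.
rewrite -[RHS](integral_shear_fst a mF2 (fun z => F0 _)).
apply: eq_integral => x _; apply: eq_integral => y _; rewrite /F2 /F1 /=.
(* [a] is minus the tangent of half the angle, the slope of the outer shears. *)
have as1 : (a * s = c - 1)%R by rewrite /a divfK.
have ac1 : (a * (1 + c) = - s)%R.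
  apply: (mulIf s0); rewrite mulrAC as1 mulNr -expr2.
  by move: cs1; rewrite !expr2; lra.
have E2 : (y + s * (x + a * y) = s * x + c * y)%R.
  transitivity (s * x + (1 + a * s) * y)%R; first by ring.
  by rewrite as1; ring.
have E1 : (x + a * y + a * (s * x + c * y) = c * x - s * y)%R.
  transitivity (x + (a * s) * x + (a * (1 + c)) * y)%R; first by ring.
  by rewrite as1 ac1; ring.
by rewrite E2 E1.
Qed.

Lemma normal_prob2E (s : R) (E : set T2) : measurable E ->
  (normal_prob 0 s \x normal_prob 0 s) E =
  \int[mu]_x \int[mu]_y
    (\1_E (x, y) * (normal_pdf 0 s x * normal_pdf 0 s y))%:E.
Proof.
move=> mE; rewrite /product_measure1 ge0_integral_normal//; last first.
  exact: measurable_fun_xsection.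
apply: eq_integral => x _.
have mpdf : measurable_fun [set: measurableTypeR R]
  (EFin \o normal_pdf 0 s) by apply/measurable_EFinP; exact: measurable_normal_pdf.
rewrite /= {1}/normal_prob integral_mkcond /=.
rewrite -ge0_integralZr//; last 3 first.
- by apply: (measurable_restrictT _ _).1 => //; [exact: measurable_xsection|exact: measurable_funTS].
- by move=> y _; rewrite patchE; case: ifP => // _; rewrite lee_fin normal_pdf_ge0.
- by rewrite lee_fin normal_pdf_ge0.
apply: eq_integral => y _; rewrite patchE indicE mem_xsection.
by case: ifP => _; rewrite ?mul0e ?mul0r// mul1r -EFinM mulrC.
Qed.

Lemma normal_pdf_rotation (s0 c s x y : R) : s0 != 0%R ->
  (c ^+ 2 + s ^+ 2 = 1)%R ->
  (normal_pdf 0 s0 (c * x - s * y) * normal_pdf 0 s0 (s * x + c * y) =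
   normal_pdf 0 s0 x * normal_pdf 0 s0 y)%R.
Proof.
move=> s00 cs1; rewrite !normal_pdfE// /normal_fun !subr0.
rewrite mulrACA [RHS]mulrACA -!expRD; congr (_ * expR _)%R.
rewrite -!mulrDl; congr (_ / _)%R.
transitivity (- ((c ^+ 2 + s ^+ 2) * (x ^+ 2 + y ^+ 2)))%R; first by ring.
by rewrite cs1 mul1r opprD.
Qed.

(** The joint density of two independent normal variables depends only on the
    distance to the origin, and Lebesgue measure is invariant under rotations. *)
Lemma normal_prob2_rotation (s0 c s : R) (B1 B2 : set (measurableTypeR R)) :
  s0 != 0%R -> (c ^+ 2 + s ^+ 2 = 1)%R -> s != 0%R ->
  measurable B1 -> measurable B2 ->
  (normal_prob 0 s0 \x normal_prob 0 s0)
    [set z : T2 | B1 (c * z.1 - s * z.2)%R /\ B2 (s * z.1 + c * z.2)%R] =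
  normal_prob 0 s0 B1 * normal_prob 0 s0 B2.
Proof.
move=> s00 cs1 sn0 mB1 mB2.
pose r (z : T2) : T2 := (c * z.1 - s * z.2, s * z.1 + c * z.2)%R.
have mr : measurable_fun setT r.
  apply/measurable_fun_pairP; split => /=.
    by apply: measurable_funB; exact: measurable_funM.
  by apply: measurable_funD; exact: measurable_funM.
have mBB : measurable (B1 `*` B2) by exact: measurableX.
have mD : measurable (r @^-1` (B1 `*` B2)).
  by rewrite -[X in measurable X]setTI; exact: mr.
rewrite (_ : [set z : T2 | _] = r @^-1` (B1 `*` B2)); last by [].
apply: (etrans (normal_prob2E s0 mD)); apply/esym.
apply: (etrans (esym (product_measure1E _ _ mB1 mB2))).
apply: (etrans (normal_prob2E s0 mBB)).
pose F (z : T2) :=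
  (\1_(B1 `*` B2) z * (normal_pdf 0 s0 z.1 * normal_pdf 0 s0 z.2))%:E.
have mF : measurable_fun setT F.
  apply/measurable_EFinP; apply: measurable_funM; first exact: measurable_indic.
  apply: measurable_funM; (apply: measurableT_comp; [exact: measurable_normal_pdf|]);
  by [exact: measurable_fst|exact: measurable_snd].
have F0 z : 0 <= F z by rewrite lee_fin !mulr_ge0 ?normal_pdf_ge0.
apply: (etrans (esym (integral_rotation cs1 sn0 mF F0))).
apply: eq_integral => x _; apply: eq_integral => y _.
by rewrite /F /= normal_pdf_rotation// !indicE.
Qed.

End plane_rotation.

(** * Products of plane rotations *)

Section givens.
Context {R : realType} {m : nat}.

Definition givens (a b : 'I_m) (c s : R) : 'M[R]_m :=
  \matrix_(i, j) if i == a then c * (j == a)%:R - s * (j == b)%:R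
                 else if i == b then s * (j == a)%:R + c * (j == b)%:R
                 else (i == j)%:R.

Lemma givens_mul n (a b : 'I_m) (c s : R) (A : 'M[R]_(m, n)) i k :
  (givens a b c s *m A) i k =
  if i == a then c * A a k - s * A b k
  else if i == b then s * A a k + c * A b k else A i k.
Proof.
have sumD (e : 'I_m) : \sum_j (j == e)%:R * A j k = A e k.
  rewrite (bigD1 e) //= eqxx mul1r big1 ?addr0// => j je.
  by rewrite (negbTE je) mul0r.
rewrite mxE; under eq_bigr do rewrite mxE.
case: ifP => _; [|case: ifP => _].
- under eq_bigr do rewrite mulrBl -!mulrA.
  by rewrite sumrB -!mulr_sumr !sumD.
- under eq_bigr do rewrite mulrDl -!mulrA.
  by rewrite big_split /= -!mulr_sumr !sumD.
- by under eq_bigr do rewrite eq_sym; exact: sumD.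
Qed.

Lemma givens_orthogonal (a b : 'I_m) (c s : R) : a != b -> c ^+ 2 + s ^+ 2 = 1 ->
  (givens a b c s)^T *m givens a b c s = 1%:M.
Proof.
move=> ab cs1; have ba : b != a by rewrite eq_sym.
apply/matrixP => i k; rewrite mxE (bigD1 a)//= (bigD1 b)//=.
have -> : (1%:M : 'M[R]_m) i k = \sum_l (l == i)%:R * (l == k)%:R.
  rewrite mxE (bigD1 i)//= eqxx mul1r big1 ?addr0// => l li.
  by rewrite (negbTE li) mul0r.
rewrite [RHS](bigD1 a)//= [in RHS](bigD1 b)//= !addrA.
congr (_ + _); last first.
  apply: eq_bigr => l /andP[/negbTE la /negbTE lb].
  by rewrite !mxE la lb.
rewrite !mxE !eqxx (negbTE ba) !(eq_sym a) !(eq_sym b).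
transitivity ((c ^+ 2 + s ^+ 2) *
  ((i == a)%:R * (k == a)%:R + (i == b)%:R * (k == b)%:R)); first by ring.
by rewrite cs1 mul1r.
Qed.

(** Invariance of Gaussian laws is only established for plane rotations, so that
    orthogonal matrices are restricted to products of these; they suffice for the
    reduction to triangular form.  The condition [s != 0] is the one under which a
    rotation splits into shears. *)
Inductive rotation : 'M[R]_m -> Prop :=
| rotation1 : rotation 1%:M
| rotation_step a b c s O : a != b -> c ^+ 2 + s ^+ 2 = 1 -> s != 0 ->
    rotation O -> rotation (givens a b c s *m O).

Lemma rotation_orthogonal O : rotation O -> O^T *m O = 1%:M.
Proof.
elim=> [|a b c s {}O ab cs1 _ _ IH]; first by rewrite trmx1 mulmx1.
by rewrite trmx_mul -mulmxA [X in _ *m X]mulmxA givens_orthogonal// mul1mx.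
Qed.

(** One step of the triangular reduction: the vector formed by the entries [(a, k)]
    and [(b, k)] is rotated onto the axis of [a].  If the entry [(b, k)] already
    vanishes then [G] is the identity, which is not a plane rotation with
    [s != 0]; this is why [G] is described by its action on rotations. *)
Lemma rotation_kill n (A : 'M[R]_(m, n)) (a b : 'I_m) (k : 'I_n) : a != b ->
  exists G : 'M[R]_m, [/\ forall O, rotation O -> rotation (G *m O),
    (G *m A) b k = 0,
    forall i l, i != a -> i != b -> (G *m A) i l = A i l &
    forall l, A a l = 0 -> A b l = 0 ->
      (G *m A) a l = 0 /\ (G *m A) b l = 0].
Proof.
move=> ab; have ba : (b == a) = false by rewrite eq_sym (negbTE ab).
have [Abk0|Abk0] := eqVneq (A b k) 0.
  exists 1%:M; rewrite mul1mx; split=> // O; by rewrite mul1mx.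
pose h := Num.sqrt (A a k ^+ 2 + A b k ^+ 2).
have h2 : 0 < A a k ^+ 2 + A b k ^+ 2.
  by rewrite ltr_wpDl ?sqr_ge0// exprn_even_gt0.
have h0 : h != 0 by rewrite gt_eqF// sqrtr_gt0.
exists (givens a b (A a k / h) (- (A b k / h))); split.
- move=> O rO; apply: rotation_step => //.
    rewrite sqrrN !exprMn -mulrDl exprVn sqr_sqrtr ?ltW// divff//.
    by rewrite gt_eqF.
  by rewrite oppr_eq0 mulf_neq0// invr_eq0.
- by rewrite givens_mul ba eqxx; ring.
- by move=> i l ia ib; rewrite givens_mul (negbTE ia) (negbTE ib).
- by move=> l al bl; rewrite !givens_mul eqxx ba eqxx al bl; split; ring.
Qed.

(** Entries below the diagonal are cleared column after column, and downwards in
    each column; the zeros already obtained survive because [rotation_kill] keeps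
    common zeros of the two rows that it changes. *)
Lemma rotation_QR n (A : 'M[R]_(m, n)) :
  exists2 O, rotation O & forall (i : 'I_m) (j : 'I_n), (j < i)%N -> (O *m A) i j = 0.
Proof.
suff: forall q : nat, exists2 O, rotation O &
    forall (i : 'I_m) (j : 'I_n), (j < q)%N -> (j < i)%N -> (O *m A) i j = 0.
  by move=> /(_ n)[Q rQ QA]; exists Q => // i j; apply: QA.
elim=> [|k [Q rQ QA]]; first by exists 1%:M => //; exact: rotation1.
have [nk|kn] := leqP n k.
  by exists Q => // i j jk; apply: QA; exact: leq_trans (ltn_ord j) nk.
have [mk|km] := leqP m k.
  exists Q => // i j jk ji; apply: QA => //.
  by rewrite (leq_trans ji)// (leq_trans (ltnW (ltn_ord i)))//.
pose ko : 'I_n := Ordinal kn; pose ka : 'I_m := Ordinal km.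
(* Cleared so far: the columns before [k], and column [k] above row [q]. *)
suff: forall q : nat, exists2 U, rotation U & forall (i : 'I_m) (j : 'I_n),
    (j < k)%N && (j < i)%N || (j == k :> nat) && (k < i)%N && (i < q)%N ->
    (U *m A) i j = 0.
  move=> /(_ m)[U rU UA]; exists U => // i j; rewrite ltnS leq_eqVlt => /orP[/eqP jk|jk] ji.
    by apply: UA; rewrite -jk eqxx ji ltn_ord orbT.
  by apply: UA; rewrite jk ji.
elim=> [|q [U rU UA]].
  exists Q => // i j; rewrite ltn0 andbF orbF => /andP[jk ji]; exact: QA.
have [mq|qm] := leqP m q.
  exists U => // i j H; apply: UA; case/orP: H => [-> //|].
  move=> /andP[/andP[-> ->] _] /=.
  by rewrite (leq_trans (ltn_ord i) mq) orbT.
have [qk|kq] := leqP q k.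
  exists U => // i j H; apply: UA; case/orP: H => [-> //|].
  move=> /andP[/andP[-> ki]]; rewrite ltnS => iq.
  by move: (leq_trans iq qk); rewrite leqNgt ki.
pose qo : 'I_m := Ordinal qm.
have kq' : ka != qo by rewrite -val_eqE /= neq_ltn kq.
have [G [rG Gq Gi Gl]] := rotation_kill (U *m A) ko kq'.
exists (G *m U); first exact: rG.
move=> i j H; rewrite -mulmxA.
case/orP: H => [/andP[jk ji]|/andP[/andP[/eqP jk ki]]].
  have UA0 : (U *m A) i j = 0 by apply: UA; rewrite jk ji.
  have [Gka Gqo] : (G *m (U *m A)) ka j = 0 /\ (G *m (U *m A)) qo j = 0.
    apply: Gl; apply: UA; first by rewrite /= jk.
    by rewrite /= jk (ltn_trans jk kq).
  have [->//|ia] := eqVneq i ka; have [->//|ib] := eqVneq i qo.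
  by rewrite Gi.
have -> : j = ko by exact/val_inj.
rewrite ltnS leq_eqVlt => /orP[/eqP iq|iq].
  by have -> : i = qo by exact/val_inj.
rewrite Gi; [|by rewrite -val_eqE /= neq_ltn ki orbT|by rewrite -val_eqE /= neq_ltn iq].
by apply: UA; rewrite eqxx ki iq orbT.
Qed.

End givens.

Section rotated_families.
Context {R : realType} (sigma : R) (sigma0 : sigma != 0).
Local Notation gam := (normal_prob 0 sigma : probability (measurableTypeR R) R).

Definition rotate {I : finType} (T : Type) (a b : I) (c s : R)
    (X : I -> T -> R) (i : I) (t : T) : R :=
  if i == a then c * X a t - s * X b t
  else if i == b then s * X a t + c * X b t else X i t.

Lemma measurable_rotate (I : finType) d (T : measurableType d)
    (a b : I) c s (X : I -> T -> R) :
  (forall i, measurable_fun setT (X i)) ->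
  forall i, measurable_fun setT (rotate a b c s X i).
Proof.
move=> mX i; rewrite /rotate; case: (i == a); [|case: (i == b) => //].
  by apply: measurable_funB; exact: measurable_funM.
by apply: measurable_funD; exact: measurable_funM.
Qed.

(** By [iid_law], [X] may be replaced by the family where the members [a] and [b]
    are the coordinates of an independent Gaussian point of the plane, for
    which the statement is [normal_prob2_rotation]. *)
Lemma iid_rotate (I : finType) d (T : measurableType d) (P : probability T R)
    (a b : I) (c s : R) (X : I -> T -> R) :
  a != b -> c ^+ 2 + s ^+ 2 = 1 -> s != 0 ->
  iid_on gam [set: I]%SET P X -> iid_on gam [set: I]%SET P (rotate a b c s X).
Proof.
move=> ab cs1 s0 iX; have ba : (b == a) = false by rewrite eq_sym (negbTE ab).
have [mX PX] := iX; split=> [|B mB]; first exact: measurable_rotate.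
pose T2 := (measurableTypeR R * measurableTypeR R)%type.
pose J : {set I} := [set a; b]%SET.
pose Y (i : I) (z : T2) : R := if i == a then z.1 else z.2.
have prodJ : (\prod_(i in J) gam (B i) = gam (B a) * gam (B b))%E.
  by rewrite /J finset.big_setU1 ?finset.in_set1//= finset.big_set1.
have iY : iid_on gam J (gam \x gam)%E Y.
  split=> [i|C mC].
    by rewrite /Y; case: (i == a); [exact: measurable_fst|exact: measurable_snd].
  have -> : [set z | forall i, i \in J -> C i (Y i z)] = C a `*` C b.
    apply/seteqP; split=> -[x y] /=.
      move=> h; have := h a; have := h b.
      rewrite /J !finset.in_set2 !eqxx orbT /Y eqxx ba /=.
      by move=> hb ha; split; [exact: ha|exact: hb].
    move=> [ha hb] i; rewrite /J finset.in_set2 /Y => /orP[/eqP ->|/eqP ->] /=.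
      by rewrite eqxx.
    by rewrite ba.
  apply: etrans; first exact: product_measure1E.
  by rewrite /J finset.big_setU1 ?finset.in_set1//= finset.big_set1.
have iXJ : iid_on gam (~: J)%SET P X by apply: iid_onS iX; exact: finset.subsetT.
have iZ := iid_on_glue iY iXJ.
pose D : set (cyl R I) :=
  [set x | forall i, B i (rotate a b c s (fun i (x : cyl R I) => x i) i x)].
have mD : measurable D.
  rewrite (_ : D = \bigcap_(i in [set: I])
     (rotate a b c s (fun i (x : cyl R I) => x i) i) @^-1` B i); last first.
    by apply/seteqP; split=> x /= h i => [_|]; exact: h.
  apply: fin_bigcap_measurable; first exact: finite_finset.
  move=> i _; rewrite -[X in measurable X]setTI.
  have mrot := @measurable_rotate I _ (cyl R I) a b c s (fun i x => x i)
    measurable_coord i.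
  exact: (mrot measurableT (B i) (mB i)).
have := iid_law iX iZ mD; rewrite /pushforward => PD.
transitivity (P (sample X @^-1` D)).
  congr (P _); apply/seteqP; split=> t /= h i => [|_]; last exact: h.
  by apply: h; rewrite finset.in_setT.
apply: (etrans PD).
have -> : sample (glue J Y X) @^-1` D =
    [set z : T2 | B a (c * z.1 - s * z.2) /\ B b (s * z.1 + c * z.2)] `*`
    [set t | forall i, i \in (~: J)%SET -> B i (X i t)].
  have aJ : a \in J by rewrite finset.in_set2 eqxx.
  have bJ : b \in J by rewrite finset.in_set2 eqxx orbT.
  have nJ i : i \in (~: J)%SET -> [/\ i \notin J, i != a & i != b].
    by rewrite finset.in_setC finset.in_set2 negb_or => /andP[-> ->].
  apply/seteqP; split=> -[z t] /=.
    move=> h; split.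
      have := h a; have := h b; rewrite /rotate /sample /glue aJ bJ /Y !eqxx ba /=.
      by [].
    move=> i /nJ[iJ ia ib]; have := h i.
    by rewrite /rotate /sample /glue (negbTE ia) (negbTE ib) (negbTE iJ).
  move=> [[ha hb] ht] i; rewrite /rotate /sample /glue aJ bJ /Y eqxx ba /=.
  case: (eqVneq i a) => [->//|ia]; case: (eqVneq i b) => [->//|ib].
  have iJ : i \notin J by rewrite finset.in_set2 negb_or ia.
  by rewrite (negbTE iJ); apply: ht; rewrite finset.in_setC.
apply: etrans; first apply: product_measure1E.
- pose r (z : T2) : T2 := (c * z.1 - s * z.2, s * z.1 + c * z.2).
  have mr : measurable_fun setT r.
    apply/measurable_fun_pairP; split => /=.
      by apply: measurable_funB; exact: measurable_funM.
    by apply: measurable_funD; exact: measurable_funM.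
  rewrite (_ : [set z | _] = r @^-1` (B a `*` B b)) //.
  rewrite -[X in measurable X]setTI; apply: mr => //; exact: measurableX.
- rewrite (_ : [set t | _] = \bigcap_(i in [set` (~: J)%SET]) X i @^-1` B i) //.
  apply: fin_bigcap_measurable; first exact: finite_finset.
  move=> i _; rewrite -[X in measurable X]setTI.
  exact: (mX i measurableT (B i) (mB i)).
rewrite iXJ.2// [RHS](big_setID J) /= finset.setTI finset.setTD.
congr (_ * _)%E; rewrite prodJ.
exact: normal_prob2_rotation.
Qed.

End rotated_families.

(** * Expectations over i.i.d. families and Gaussian matrices *)

Section iid_integrals.
Context {R : realType} (g : probability (measurableTypeR R) R) {I : finType}.
Local Open Scope ereal_scope.

Lemma iid_integral
    d1 (T1 : measurableType d1) (P1 : {measure set T1 -> \bar R}) X1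
    d2 (T2 : measurableType d2) (P2 : {measure set T2 -> \bar R}) X2
    (F : cyl R I -> \bar R) :
  iid_on g [set: I]%SET P1 X1 -> iid_on g [set: I]%SET P2 X2 ->
  measurable_fun setT F -> (forall x, 0 <= F x) ->
  \int[P1]_t F (sample X1 t) = \int[P2]_t F (sample X2 t).
Proof.
move=> iX1 iX2 mF F0.
have m1 := measurable_family iX1.1; have m2 := measurable_family iX2.1.
have E1 : \int[pushforward P1 (sample X1)]_x F x = \int[P1]_t F (sample X1 t).
  by rewrite (ge0_integral_pushforward m1).
have E2 : \int[pushforward P2 (sample X2)]_x F x = \int[P2]_t F (sample X2 t).
  by rewrite (ge0_integral_pushforward m2).
rewrite -E1 -E2.
apply: (@eq_measure_integral _ _ _ _
  (measure_function_pushforward__canonical__measure_function_Measure P2 m2)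
  (measure_function_pushforward__canonical__measure_function_Measure P1 m1)).
by move=> A mA _; exact: (iid_law iX1 iX2 mA).
Qed.

(** Induction on the number of factors: one member of the family is moved to an
    independent copy, and Fubini's theorem separates its factor. *)
Lemma iid_integral_prod d (T : measurableType d) (P : probability T R) X
    (f : I -> R -> \bar R) (J : {set I}) :
  iid_on g [set: I]%SET P X ->
  (forall i, measurable_fun [set: measurableTypeR R] (f i)) ->
  (forall i x, 0 <= f i x) ->
  \int[P]_t (\prod_(i in J) f i (X i t)) = \prod_(i in J) \int[g]_x f i x.
Proof.
move=> iX mf f0.
have mfc i : measurable_fun [set: cyl R I] (fun x : cyl R I => f i (x i)).
  by apply: (measurableT_comp (mf i)); exact: measurable_coord.
have mprod (K : {set I}) : measurable_fun [set: cyl R I]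
    (fun x : cyl R I => \prod_(i in K) f i (x i)).
  rewrite (_ : (fun _ => _) = (fun x => \prod_(i <- enum K) f i (x i))).
    elim: (enum K) => [|j s IH].
      rewrite (_ : (fun x : cyl R I => _) = cst 1); first exact: measurable_cst.
      by apply/funext => x; rewrite big_nil.
    rewrite (_ : (fun x : cyl R I => _) =
      (fun x => f j (x j) * \prod_(i <- s) f i (x i))).
      exact: emeasurable_funM.
    by apply/funext => x; rewrite big_cons.
  by apply/funext => x; rewrite big_enum.
have prod0 (K : {set I}) (x : I -> R) : 0 <= \prod_(i in K) f i (x i).
  by apply: prode_ge0 => i _.
have [n] := ubnP #|J|; elim: n J => // n IH J; rewrite ltnS => Jn.
case: (set_0Vmem J) => [->|[j jJ]].
  rewrite finset.big_set0; under eq_integral do rewrite finset.big_set0.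
  by rewrite integral_cst// mul1e; exact: probability_setT.
pose X1 (i : I) (x : measurableTypeR R) : R := x.
have iX1 : iid_on g [set j]%SET g X1.
  split=> [i|B mB]; first exact: measurable_id.
  rewrite finset.big_set1; congr (g _); apply/seteqP; split=> x /=.
    by apply; rewrite finset.in_set1.
  by move=> Bx i; rewrite finset.in_set1 => /eqP ->.
have iXC : iid_on g (~: [set j])%SET P X.
  by apply: iid_onS iX; exact: finset.subsetT.
have iZ := iid_on_glue iX1 iXC.
rewrite (iid_integral iX iZ (mprod J) (prod0 J)).
have EJ (h : I -> \bar R) : \prod_(i in J) h i = h j * \prod_(i in (J :\ j)%SET) h i.
  by rewrite (big_setD1 j).
rewrite EJ -IH; last by move: Jn; rewrite (cardsD1 j) jJ.
pose F (z : measurableTypeR R * T) := f j z.1 * \prod_(i in (J :\ j)%SET) f i (X i z.2).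
have mX : measurable_fun setT (sample X) := measurable_family iX.1.
have mF2 : measurable_fun [set: T] (fun t => \prod_(i in (J :\ j)%SET) f i (X i t)).
  exact: (measurableT_comp (mprod (J :\ j)%SET) mX).
have mF : measurable_fun setT F.
  apply: emeasurable_funM.
    by apply: (measurableT_comp (mf j)); exact: measurable_fst.
  by apply: (measurableT_comp mF2); exact: measurable_snd.
have F0 z : 0 <= F z by rewrite mule_ge0.
have -> : \int[g \x P]_z (\prod_(i in J) f i (sample (glue [set j]%SET X1 X) z i)) =
    \int[g \x P]_z F z.
  apply: eq_integral => -[x t] _; rewrite /F EJ /sample /glue /X1 finset.in_set1 eqxx.
  congr (_ * _); apply: eq_bigr => i; rewrite finset.in_setD1 => /andP[ij _].
  by rewrite finset.in_set1 (negbTE ij).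
rewrite fubini_tonelli1//.
under eq_integral => x _.
  rewrite /fubini_F /F /= ge0_integralZl//.
  over.
rewrite ge0_integralZr//.
by apply: integral_ge0.
Qed.

End iid_integrals.

Section gaussian_matrix.
Context {R : realType} (sigma : R) (sigma0 : sigma != 0).
Local Notation gam := (normal_prob 0 sigma : probability (measurableTypeR R) R).

Definition mxof {m n} {T : Type} (X : 'I_m * 'I_n -> T -> R) (t : T) : 'M[R]_(m, n) :=
  \matrix_(i, j) X (i, j) t.

Definition mulfam {m n} {T : Type} (O : 'M[R]_m) (X : 'I_m * 'I_n -> T -> R)
  (ij : 'I_m * 'I_n) (t : T) : R := (O *m mxof X t) ij.1 ij.2.

Lemma mxof_mulfam m n (T : Type) (O : 'M[R]_m) (X : 'I_m * 'I_n -> T -> R) t :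
  mxof (mulfam O X) t = O *m mxof X t.
Proof. by apply/matrixP => i j; rewrite mxE. Qed.

(** A plane rotation of the rows acts on each column separately; the columns are
    rotated one at a time by [iid_rotate]. *)
Lemma iid_givens m n d (T : measurableType d) (P : probability T R)
    (a b : 'I_m) (c s : R) (X : 'I_m * 'I_n -> T -> R) :
  a != b -> c ^+ 2 + s ^+ 2 = 1 -> s != 0 ->
  iid_on gam [set: 'I_m * 'I_n]%SET P X ->
  iid_on gam [set: 'I_m * 'I_n]%SET P (mulfam (givens a b c s) X).
Proof.
move=> ab cs1 s0 iX.
(* [Y q] is [X] with only the columns listed in [q] rotated. *)
pose Y (q : seq 'I_n) (ij : 'I_m * 'I_n) t :=
  if ij.2 \in q then mulfam (givens a b c s) X ij t else X ij t.
suff iY q : uniq q -> iid_on gam [set: 'I_m * 'I_n]%SET P (Y q).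
  suff -> : mulfam (givens a b c s) X = Y (enum 'I_n) by apply: iY; exact: enum_uniq.
  by apply/funext => ij; apply/funext => t; rewrite /Y mem_enum.
elim: q => [_|j q IH /= /andP[jq uq]].
  by rewrite (_ : Y [::] = X)//; apply/funext => ij; apply/funext.
have -> : Y (j :: q) = rotate (a, j) (b, j) c s (Y q).
  apply/funext => -[i l]; apply/funext => t; rewrite /Y /rotate /= (negbTE jq) inE.
  have [->|lj] /= := eqVneq l j.
    rewrite !xpair_eqE eqxx !andbT /mulfam /= givens_mul !mxE (negbTE jq).
    by case: (i == a); case: (i == b).
  by rewrite !xpair_eqE (negbTE lj) !andbF.
apply: iid_rotate => //; last exact: IH.
by rewrite xpair_eqE (negbTE ab).
Qed.

Lemma iid_rotation m n d (T : measurableType d) (P : probability T R)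
    (O : 'M[R]_m) (X : 'I_m * 'I_n -> T -> R) :
  rotation O -> iid_on gam [set: 'I_m * 'I_n]%SET P X ->
  iid_on gam [set: 'I_m * 'I_n]%SET P (mulfam O X).
Proof.
move=> rO iX; elim: rO => [|a b c s U ab cs1 s0 _ IH].
  suff -> : mulfam 1%:M X = X by [].
  by apply/funext => -[i j]; apply/funext => t; rewrite /mulfam mul1mx mxE.
have -> : mulfam (givens a b c s *m U) X = mulfam (givens a b c s) (mulfam U X).
  apply/funext => -[i j]; apply/funext => t.
  by rewrite /mulfam mxof_mulfam mulmxA.
exact: iid_givens.
Qed.

(** Up to the constant, the integrand is the density of a normal law with standard
    deviation [sigma / Num.sqrt (1 - 2 * sigma ^+ 2 * w)]. *)
Lemma normal_mgf_sqr (w : R) : 0 < 1 - 2 * sigma ^+ 2 * w ->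
  (\int[normal_prob 0 sigma]_x (expR (w * x ^+ 2))%:E =
   (Num.sqrt (1 - 2 * sigma ^+ 2 * w))^-1%:E)%E.
Proof.
move=> w1; set q := Num.sqrt _.
have q0 : 0 < q by rewrite sqrtr_gt0.
pose tau := sigma / q.
have tau0 : tau != 0 by rewrite mulf_neq0// invr_eq0 gt_eqF.
have mf : measurable_fun [set: measurableTypeR R]
    (fun x : R => (expR (w * x ^+ 2))%:E).
  apply/measurable_EFinP; apply: measurableT_comp => //.
  by apply: measurable_funM => //; exact: measurable_funX.
rewrite (ge0_integral_normal sigma mf); last first.
  by move=> x; rewrite lee_fin expR_ge0.
transitivity (\int[lebesgue_measure]_x (q^-1%:E * (normal_pdf 0 tau x)%:E))%E;
    last first.
  rewrite ge0_integralZl//.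
  - by rewrite integral_normal_pdf mule1.
  - by apply/measurable_EFinP; exact: measurable_normal_pdf.
  - by move=> x _; rewrite lee_fin normal_pdf_ge0.
  - by rewrite lee_fin invr_ge0 ltW.
apply: eq_integral => x _; rewrite -!EFinM; congr EFin.
rewrite !normal_pdfE// /normal_fun !subr0 mulrCA -expRD [RHS]mulrA; congr (_ * expR _).
- rewrite /normal_peak -!mulrnAr !(sqrtrM (pi *+ 2)) ?sqr_ge0// !sqrtr_sqr.
  rewrite /tau normrM normfV (gtr0_norm q0) !invfM invrK.
  by rewrite -[in RHS]mulrA [RHS]mulrCA mulKf ?gt_eqF.
- have q2 : q ^+ 2 = 1 - 2 * sigma ^+ 2 * w by rewrite sqr_sqrtr// ltW.
  have s2 : sigma ^+ 2 != 0 by rewrite expf_neq0.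
  rewrite /tau expr_div_n q2; field.
  by rewrite sigma0 gt_eqF.
Qed.

End gaussian_matrix.

(** * The projection along the range of a matrix *)

Section residual.
Context {R : realType}.

Definition sqn {m} (x : 'cV[R]_m) : R := \sum_i x i 0 ^+ 2.

Lemma sqnE m (x : 'cV[R]_m) : sqn x = (x^T *m x) 0 0.
Proof. by rewrite mxE; apply: eq_bigr => i _; rewrite mxE expr2. Qed.

Lemma sqn_ge0 m (x : 'cV[R]_m) : 0 <= sqn x.
Proof. by apply: sumr_ge0 => i _; exact: sqr_ge0. Qed.

Lemma sqn_eq0 m (x : 'cV[R]_m) : (sqn x == 0) = (x == 0).
Proof.
apply/eqP/eqP => [|->]; last by rewrite /sqn big1// => i _; rewrite mxE expr0n.
move/eqP; rewrite psumr_eq0 => [/allP x0|i _]; last exact: sqr_ge0.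
apply/matrixP => i j; rewrite ord1 mxE.
by have := x0 i (mem_index_enum i); rewrite sqrf_eq0 => /eqP.
Qed.

Lemma sqnZ m (a : R) (x : 'cV[R]_m) : sqn (a *: x) = a ^+ 2 * sqn x.
Proof. by rewrite /sqn mulr_sumr; apply: eq_bigr => i _; rewrite mxE exprMn. Qed.

Lemma sqn_isometry m (O : 'M[R]_m) (x : 'cV[R]_m) :
  O^T *m O = 1%:M -> sqn (O *m x) = sqn x.
Proof. by move=> OO; rewrite !sqnE trmx_mul -mulmxA (mulmxA O^T) OO mul1mx. Qed.

Definition gram {m n} (A : 'M[R]_(m, n)) : 'M[R]_n := A^T *m A.

(** The orthogonal projection along the range of [A], when [A] is injective.  It is
    written with determinant and adjugate, so that it is visibly a measurable function
    of the entries of [A]. *)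
Definition residual {m n} (A : 'M[R]_(m, n)) : 'M[R]_m :=
  1%:M - (\det (gram A))^-1 *: (A *m \adj (gram A) *m A^T).

Lemma gram_rotate m n (O : 'M[R]_m) (A : 'M[R]_(m, n)) :
  O^T *m O = 1%:M -> gram (O *m A) = gram A.
Proof. by move=> OO; rewrite /gram trmx_mul -mulmxA (mulmxA O^T) OO mul1mx. Qed.

Lemma residual_rotate m n (O : 'M[R]_m) (A : 'M[R]_(m, n)) :
  O^T *m O = 1%:M -> residual (O *m A) *m O = O *m residual A.
Proof.
move=> OO; rewrite /residual gram_rotate// mulmxBl mulmxBr mul1mx mulmx1.
congr (_ - _); rewrite -scalemxAl -scalemxAr; congr (_ *: _).
by rewrite trmx_mul !mulmxA -(mulmxA _ O^T) OO mulmx1.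
Qed.

Lemma sqn_residual_rotate m n (O : 'M[R]_m) (A : 'M[R]_(m, n)) x :
  O^T *m O = 1%:M ->
  sqn (residual (O *m A) *m (O *m x)) = sqn (residual A *m x).
Proof.
by move=> OO; rewrite mulmxA residual_rotate// -mulmxA sqn_isometry.
Qed.

Lemma residualE m n (A : 'M[R]_(m, n)) : \det (gram A) != 0 ->
  residual A = 1%:M - A *m invmx (gram A) *m A^T.
Proof.
move=> d0; have uG : gram A \in unitmx by rewrite unitmxE unitfE.
by rewrite /residual /invmx uG -scalemxAr -scalemxAl.
Qed.

Lemma tr_gram m n (A : 'M[R]_(m, n)) : (gram A)^T = gram A.
Proof. by rewrite /gram trmx_mul trmxK. Qed.

Lemma tr_residual m n (A : 'M[R]_(m, n)) : (residual A)^T = residual A.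
Proof.
rewrite /residual linearB /= trmx1 linearZ /= !trmx_mul trmxK trmx_adj tr_gram.
by rewrite mulmxA.
Qed.

Lemma residual_mul m n (A : 'M[R]_(m, n)) : \det (gram A) != 0 ->
  residual A *m A = 0.
Proof.
move=> d0; have uG : gram A \in unitmx by rewrite unitmxE unitfE.
rewrite residualE// mulmxBl mul1mx -!mulmxA -/(gram A) mulVmx// mulmx1.
exact: subrr.
Qed.

Lemma residual_idem m n (A : 'M[R]_(m, n)) : \det (gram A) != 0 ->
  residual A *m residual A = residual A.
Proof.
move=> d0; rewrite {2}(residualE d0) mulmxBr mulmx1 !mulmxA residual_mul//.
by rewrite !mul0mx subr0.
Qed.

Lemma sqn_mulmx k m (M : 'M[R]_(k, m)) (x : 'cV[R]_m) :
  sqn (M *m x) = (x^T *m (M^T *m M *m x)) 0 0.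
Proof. by rewrite sqnE trmx_mul -!mulmxA. Qed.

Lemma sqn_residual_le m n (A : 'M[R]_(m, n)) x : \det (gram A) != 0 ->
  sqn (residual A *m x) <= sqn x.
Proof.
move=> d0; set P := residual A; pose Q := 1%:M - P.
have PP : P^T *m P = P by rewrite tr_residual residual_idem.
have QQ : Q^T *m Q = Q.
  have -> : Q^T = Q by rewrite /Q linearB /= trmx1 tr_residual.
  rewrite /Q mulmxBl mul1mx mulmxBr mulmx1.
  by rewrite residual_idem// subrr subr0.
have -> : sqn x = sqn (P *m x) + sqn (Q *m x).
  rewrite !sqn_mulmx PP QQ sqnE (_ : forall B C : 'M[R]_1, B 0 0 + C 0 0 = (B + C) 0 0);
    last by move=> B C; rewrite mxE.
  rewrite -mulmxDr -mulmxDl.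
  by rewrite /Q addrC subrK mul1mx.
by rewrite lerDl sqn_ge0.
Qed.

(** The range is then spanned by the first [n] basis vectors, whatever the
    invertible matrix [U] is. *)
Lemma residual_col_mx n p (U : 'M[R]_n) :
  \det (gram (col_mx U (0 : 'M[R]_(p, n)))) != 0 ->
  residual (col_mx U (0 : 'M[R]_(p, n))) = block_mx 0 0 0 1%:M.
Proof.
set A := col_mx _ _ => d0.
have GE : gram A = U^T *m U.
  by rewrite /gram tr_col_mx mul_row_col trmx0 mul0mx addr0.
have uU : U \in unitmx.
  move: d0; rewrite GE det_mulmx det_tr mulf_eq0 negb_or => /andP[_].
  by rewrite unitmxE unitfE.
have UNU : U *m invmx (U^T *m U) *m U^T = 1%:M.
  by apply: mulmx1C; rewrite mulmxA mulmxV// unitmx_mul unitmx_tr uU.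
rewrite residualE// GE /A mul_col_mx mul0mx tr_col_mx trmx0.
rewrite mul_col_row UNU mulmx0 !mul0mx.
rewrite (scalar_mx_block n p (1 : R)) opp_block_mx add_block_mx.
by rewrite !oppr0 !addr0 subrr.
Qed.

Lemma sqn_residual_col_mx n p (U : 'M[R]_n) (y : 'cV[R]_(n + p)) :
  \det (gram (col_mx U (0 : 'M[R]_(p, n)))) != 0 ->
  sqn (residual (col_mx U (0 : 'M[R]_(p, n))) *m y) =
  \sum_(i < p) y (rshift n i) 0 ^+ 2.
Proof.
move=> d0; rewrite residual_col_mx// -{1}(vsubmxK y) mul_block_col !mul0mx.
rewrite mul1mx !add0r /sqn big_split_ord /= big1 ?add0r; last first.
  by move=> i _; rewrite col_mxEu mxE expr0n.
by apply: eq_bigr => i _; rewrite col_mxEd mxE.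
Qed.

(** If [gram A] kills [v], then so does the quadratic form, which is the squared norm of
    [A *m v]. *)
Lemma gram_unit_of_inj m n (A : 'M[R]_(m, n)) :
  (forall v : 'cV[R]_n, A *m v = 0 -> v = 0) -> \det (gram A) != 0.
Proof.
move=> Ainj; rewrite -unitfE -unitmxE -unitmx_tr -row_free_unit.
apply/inj_row_free => v vG; apply: trmx_inj; rewrite trmx0; apply: Ainj.
apply/eqP; rewrite -sqn_eq0 sqnE trmx_mul trmxK.
rewrite -mulmxA (mulmxA A^T) -/(gram A) mulmxA -{1}(tr_gram A) vG.
by rewrite mul0mx mxE.
Qed.

End residual.

(** * Measurability, and the exponential Markov inequality *)

Section measurable_matrices.
Context {R : realType} {d : measure_display} {T : measurableType d}.

(** The inverse is total, with value [0] at [0], and is not continuous there;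
    the formula in the proof uses measurable functions only, and its first factor
    gives the right value at [0]. *)
Lemma measurable_inv (f : T -> R) : measurable_fun setT f ->
  measurable_fun setT (fun t => (f t)^-1).
Proof.
move=> mf.
have -> : (fun t => (f t)^-1) = (fun t => f t * expR (- ln (f t ^+ 2))).
  apply/funext => t; have [->|ft0] := eqVneq (f t) 0.
    by rewrite invr0 mul0r.
  rewrite expRN lnK; first by rewrite expr2 invfM mulrA divff// mul1r.
  by rewrite posrE exprn_even_gt0.
apply: measurable_funM => //; apply: measurableT_comp => //.
apply: measurable_funN; apply: measurableT_comp; first exact: measurable_ln.
exact: measurable_funX.
Qed.

Definition measurable_mx {m n} (A : T -> 'M[R]_(m, n)) :=
  forall i j, measurable_fun setT (fun t => A t i j).

Lemma measurable_mx_cst m n (A : 'M[R]_(m, n)) : measurable_mx (fun=> A).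
Proof. by move=> i j; exact: measurable_cst. Qed.

Lemma measurable_mx_tr m n (A : T -> 'M[R]_(m, n)) :
  measurable_mx A -> measurable_mx (fun t => (A t)^T).
Proof.
by move=> mA i j; under eq_fun do rewrite mxE; exact: mA.
Qed.

Lemma measurable_mx_mul m n k (A : T -> 'M[R]_(m, n)) (B : T -> 'M[R]_(n, k)) :
  measurable_mx A -> measurable_mx B -> measurable_mx (fun t => A t *m B t).
Proof.
move=> mA mB i j; under eq_fun do rewrite mxE.
by apply: measurable_sum => l; exact: measurable_funM.
Qed.

Lemma measurable_mx_sub m n (A B : T -> 'M[R]_(m, n)) :
  measurable_mx A -> measurable_mx B -> measurable_mx (fun t => A t - B t).
Proof.
move=> mA mB i j; under eq_fun do rewrite mxE mxE.
exact: measurable_funB.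
Qed.

Lemma measurable_mx_scale m n (f : T -> R) (A : T -> 'M[R]_(m, n)) :
  measurable_fun setT f -> measurable_mx A ->
  measurable_mx (fun t => f t *: A t).
Proof.
by move=> mf mA i j; under eq_fun do rewrite mxE; exact: measurable_funM.
Qed.

Lemma measurable_det n (A : T -> 'M[R]_n) :
  measurable_mx A -> measurable_fun setT (fun t => \det (A t)).
Proof.
move=> mA; apply: measurable_sum => s; apply: measurable_funM => //.
by apply: measurable_prod => i _.
Qed.

Lemma measurable_mx_adj n (A : T -> 'M[R]_n) :
  measurable_mx A -> measurable_mx (fun t => \adj (A t)).
Proof.
move=> mA i j; under eq_fun do rewrite mxE /cofactor.
apply: measurable_funM => //; apply: measurable_det => k l.
by under eq_fun do rewrite !mxE; exact: mA.
Qed.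

Lemma measurable_mx_residual m n (A : T -> 'M[R]_(m, n)) :
  measurable_mx A -> measurable_mx (fun t => residual (A t)).
Proof.
move=> mA; have mG : measurable_mx (fun t => gram (A t)).
  by apply: measurable_mx_mul => //; exact: measurable_mx_tr.
apply: measurable_mx_sub; first exact: measurable_mx_cst.
apply: measurable_mx_scale; first by apply: measurable_inv; exact: measurable_det.
apply: measurable_mx_mul; last exact: measurable_mx_tr.
by apply: measurable_mx_mul => //; exact: measurable_mx_adj.
Qed.

Lemma measurable_sqn m (x : T -> 'cV[R]_m) :
  measurable_mx x -> measurable_fun setT (fun t => sqn (x t)).
Proof.
by move=> mx; apply: measurable_sum => i; apply: measurable_funX.
Qed.

(** The sign of [excess s c A x] compares the squared norm of the projection of [x]
    with the fraction [c] of that of [x].  For [0 < s] it is positive when the projection is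
    too short, for [s < 0] when it is too long; [s] is also the
    parameter of the exponential Markov inequality. *)
Definition excess (s c : R) {m n} (A : 'M[R]_(m, n)) (x : 'cV[R]_m) : R :=
  s * (c * sqn x - sqn (residual A *m x)).

Lemma measurable_excess s c m n (A : T -> 'M[R]_(m, n)) (x : T -> 'cV[R]_m) :
  measurable_mx A -> measurable_mx x ->
  measurable_fun setT (fun t => excess s c (A t) (x t)).
Proof.
move=> mA mx; apply: measurable_funM => //; apply: measurable_funB.
  by apply: measurable_funM => //; exact: measurable_sqn.
apply: measurable_sqn; apply: measurable_mx_mul => //.
exact: measurable_mx_residual.
Qed.

Lemma measurable_mxof m n (X : 'I_m * 'I_n -> T -> R) :
  (forall i, measurable_fun setT (X i)) -> measurable_mx (mxof X).
Proof. by move=> mX i j; under eq_fun do rewrite mxE; exact: mX. Qed.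

Lemma measurable_gt0 (f : T -> R) : measurable_fun setT f ->
  measurable [set t | 0 < f t].
Proof.
move=> mf; rewrite (_ : [set t | _] = f @^-1` `]0, +oo[%classic); last first.
  by apply/seteqP; split=> t /=; rewrite in_itv/= andbT.
by rewrite -[X in measurable X]setTI; apply: mf => //; exact: measurable_itv.
Qed.

Lemma measurable_eq0 (f : T -> R) : measurable_fun setT f ->
  measurable [set t | f t = 0].
Proof.
move=> mf; rewrite (_ : [set t | _] = f @^-1` [set 0])//.
by rewrite -[X in measurable X]setTI; apply: mf.
Qed.

End measurable_matrices.

Section chernoff.
Context {R : realType} (sigma : R) (sigma0 : sigma != 0).
Local Notation gam := (normal_prob 0 sigma : probability (measurableTypeR R) R).

Lemma excess_rotate m n (s c : R) (O : 'M[R]_m) (A : 'M[R]_(m, n)) x :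
  O^T *m O = 1%:M -> excess s c (O *m A) (O *m x) = excess s c A x.
Proof. by move=> OO; rewrite /excess sqn_isometry// sqn_residual_rotate. Qed.

(** A rotation makes the range of [A] the span of the first [n] basis vectors.  Then
    [excess] is a linear combination of squares of independent normal variables, with
    weight [s * c] for the first [n] and [s * (c - 1)] for the others, so that the
    expectation of its exponential factors into the integrals of [normal_mgf_sqr]. *)
Lemma chernoff_excess n p d (T : measurableType d) (P : probability T R)
    (X : 'I_(n + p) * 'I_1 -> T -> R) (A : 'M[R]_(n + p, n)) (s c : R) :
  iid_on gam [set: 'I_(n + p) * 'I_1]%SET P X ->
  \det (gram A) != 0 ->
  0 < 1 - 2 * sigma ^+ 2 * (s * c) ->
  0 < 1 - 2 * sigma ^+ 2 * (s * (c - 1)) ->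
  (P [set t | (0 < excess s c A (mxof X t))%R] <=
   ((Num.sqrt (1 - 2 * sigma ^+ 2 * (s * c)))^-1 ^+ n *
    (Num.sqrt (1 - 2 * sigma ^+ 2 * (s * (c - 1))))^-1 ^+ p)%:E)%E.
Proof.
move=> iX d0 h1 h2.
have [Q rQ QA] := rotation_QR A; have QQ := rotation_orthogonal rQ.
have QAE : Q *m A = col_mx (usubmx (Q *m A)) 0.
  rewrite -[LHS]vsubmxK; congr col_mx; apply/matrixP => i j.
  by rewrite [RHS]mxE mxE; apply: QA => /=; rewrite (leq_trans (ltn_ord j))// leq_addr.
set U := usubmx _ in QAE.
have dU : \det (gram (col_mx U (0 : 'M[R]_(p, n)))) != 0.
  by rewrite -QAE gram_rotate.
have iY := iid_rotation sigma0 rQ iX; set Y := mulfam Q X in iY.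
pose w (i : 'I_(n + p)) : R := if (i < n)%N then s * c else s * (c - 1).
have w_lt i : 0 < 1 - 2 * sigma ^+ 2 * w i by rewrite /w; case: ifP.
have excessE t : excess s c A (mxof X t) = \sum_i w i * (Y (i, 0) t) ^+ 2.
  rewrite -(excess_rotate s c A (mxof X t) QQ) QAE /excess sqn_residual_col_mx//.
  have -> : Q *m mxof X t = mxof Y t by rewrite mxof_mulfam.
  rewrite mulrBr mulrA /sqn !mulr_sumr !big_split_ord /= -addrA; congr (_ + _).
    by apply: eq_bigr => i _; rewrite mxE /w /= ltn_ord.
  rewrite -sumrB; apply: eq_bigr => i _.
  by rewrite mxE /w /= ltnNge leq_addr /=; ring.
have mY : measurable_mx (mxof Y) by apply: measurable_mxof; exact: iY.1.
have mX : measurable_mx (mxof X) by apply: measurable_mxof; exact: iX.1.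
have mexc : measurable_fun setT (fun t => excess s c A (mxof X t)).
  by apply: measurable_excess => //; exact: measurable_mx_cst.
have mE := measurable_gt0 mexc.
rewrite -(setIT [set t | _]) -integral_indic//.
apply: (@le_trans _ _ (\int[P]_t (expR (excess s c A (mxof X t)))%:E)%E).
  apply: ge0_le_integral => //.
  - by apply/measurable_EFinP; exact: measurable_indic.
  - by apply/measurable_EFinP; exact: measurableT_comp.
  - move=> t _; rewrite lee_fin indicE.
    case: (boolP (t \in _)) => [|_]; last exact: expR_ge0.
    by rewrite inE /= => ht; rewrite (le_trans _ (expR_ge1Dx _))// lerDl ltW.
pose f (ij : 'I_(n + p) * 'I_1) (x : R) := (expR (w ij.1 * x ^+ 2))%:E.
have -> : (\int[P]_t (expR (excess s c A (mxof X t)))%:E =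
    \int[P]_t \prod_(ij in [set: 'I_(n + p) * 'I_1]%SET) f ij (Y ij t))%E.
  apply: eq_integral => t _; rewrite excessE expR_sum.
  rewrite [RHS](eq_bigl xpredT); last by move=> ij; rewrite finset.in_setT.
  rewrite -(pair_bigA _ (fun i j => f (i, j) (Y (i, j) t))) /=.
  rewrite -prodEFin; apply: eq_bigr => i _.
  by rewrite big_ord1.
rewrite (iid_integral_prod _ iY); last 2 first.
- move=> ij; apply/measurable_EFinP; apply: measurableT_comp => //.
  by apply: measurable_funM => //; exact: measurable_funX.
- by move=> ij x; rewrite lee_fin expR_ge0.
rewrite (eq_bigl xpredT); last by move=> ij; rewrite finset.in_setT.
rewrite -(pair_bigA _ (fun i j => \int[gam]_x f (i, j) x)%E) /=.
under eq_bigr do rewrite big_ord1 /f /= normal_mgf_sqr//.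
rewrite prodEFin lee_fin big_split_ord /=.
under eq_bigr do rewrite /w /= ltn_ord.
rewrite prodr_const card_ord.
under eq_bigr do rewrite /w /= ltnNge leq_addr /=.
by rewrite prodr_const card_ord.
Qed.

End chernoff.

(** * The tail bound for a fixed matrix, and almost sure full rank *)

Section tails.
Context {R : realType} (sigma : R) (sigma0 : sigma != 0).
Local Notation gam := (normal_prob 0 sigma : probability (measurableTypeR R) R).

(** The bound for the optimal parameter: squared, it is
    [((1 - b * kappa) / (1 - kappa)) ^+ n * b ^+ p], and [1 + y <= expR y] bounds this
    by [(b * expR (1 - b)) ^+ p], because [n * kappa = p * (1 - kappa)]. *)
Lemma chernoff_value (n p : nat) (b theta : R) : (0 < n)%N ->
  let kappa := p%:R / (n + p)%:R in
  0 < b -> b * kappa < 1 -> b * expR (1 - b) <= expR (- (2 * theta)) ->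
  (Num.sqrt ((1 - kappa) / (1 - b * kappa)))^-1 ^+ n *
  (Num.sqrt b^-1)^-1 ^+ p <= expR (- theta * p%:R).
Proof.
move=> n0 kappa b0 bk1 hb.
have m0 : (0 : R) < (n + p)%:R by rewrite ltr0n addn_gt0 n0.
have n0' : (0 : R) < n%:R by rewrite ltr0n.
have kE : 1 - kappa = n%:R / (n + p)%:R.
  by rewrite /kappa natrD; field; rewrite -natrD gt_eqF.
have k1 : 0 < 1 - kappa by rewrite kE divr_gt0.
have q0 : 0 < (1 - kappa) / (1 - b * kappa) by rewrite divr_gt0// subr_gt0.
rewrite -(@ler_pXn2r _ 2)// ?nnegrE ?mulr_ge0 ?exprn_ge0 ?invr_ge0 ?expR_ge0//.
have sq2 (y : R) k : 0 < y -> ((Num.sqrt y)^-1 ^+ k) ^+ 2 = y^-1 ^+ k.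
  by move=> y0; rewrite -exprM mulnC exprM exprVn sqr_sqrtr// ltW.
rewrite exprMn !sq2 ?invr_gt0// invrK invf_div.
have hE : (1 - b * kappa) / (1 - kappa) = 1 + kappa * (1 - b) / (1 - kappa).
  by field; rewrite gt_eqF.
rewrite hE; apply: (@le_trans _ _ (expR (kappa * (1 - b) / (1 - kappa)) ^+ n * b ^+ p)).
  apply: ler_wpM2r; first by rewrite exprn_ge0// ltW.
  apply: lerXn2r; rewrite ?nnegrE ?expR_ge0//; last exact: expR_ge1Dx.
  by rewrite -hE divr_ge0// ltW// subr_gt0.
rewrite -expRM_natl.
have -> : n%:R * (kappa * (1 - b) / (1 - kappa)) = p%:R * (1 - b).
  rewrite kE /kappa natrD; field.
  by rewrite -natrD !gt_eqF.
rewrite expRM_natl -exprMn mulrC -expRM_natl.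
have -> : 2%:R * (- theta * p%:R) = p%:R * (- (2 * theta)) by ring.
rewrite expRM_natl; apply: lerXn2r; rewrite ?nnegrE ?mulr_ge0 ?expR_ge0//.
exact: ltW.
Qed.

(** One statement for the two tails: [1 - b] is positive for the lower tail
    ([b < 1]) and negative for the upper one ([1 < b]). *)
Lemma tail_fixed_matrix n p d (T : measurableType d) (P : probability T R)
    (X : 'I_(n + p) * 'I_1 -> T -> R) (A : 'M[R]_(n + p, n)) (b theta : R) :
  (0 < n)%N ->
  iid_on gam [set: 'I_(n + p) * 'I_1]%SET P X -> \det (gram A) != 0 ->
  0 < b -> b * (p%:R / (n + p)%:R) < 1 ->
  b * expR (1 - b) <= expR (- (2 * theta)) ->
  (P [set t | (0 < excess (1 - b) (b * (p%:R / (n + p)%:R)) A (mxof X t))%R] <=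
   (expR (- theta * p%:R))%:E)%E.
Proof.
move=> n0 iX d0 b0 bk1 hb; set kappa := p%:R / (n + p)%:R in bk1 *.
have s20 : 0 < sigma ^+ 2 by rewrite exprn_even_gt0.
have bk0 : 0 < 1 - b * kappa by rewrite subr_gt0.
(* The multiple of [1 - b] that minimizes the bound of [chernoff_excess]. *)
pose l := (2 * sigma ^+ 2 * b * (1 - b * kappa))^-1.
have l0 : 0 < l by rewrite invr_gt0 mulr_gt0// mulr_gt0// mulr_gt0.
have -> : [set t | 0 < excess (1 - b) (b * kappa) A (mxof X t)] =
          [set t | 0 < excess (l * (1 - b)) (b * kappa) A (mxof X t)].
  have exE A' x : excess (l * (1 - b)) (b * kappa) A' x =
      l * excess (1 - b) (b * kappa) (A' : 'M[R]_(n + p, n)) x.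
    by rewrite /excess [RHS]mulrA.
  by apply/seteqP; split=> t /=; rewrite exE (pmulr_rgt0 _ l0).
have k1 : 0 < 1 - kappa.
  have m0 : (0 : R) < (n + p)%:R by rewrite ltr0n addn_gt0 n0.
  rewrite (_ : 1 - kappa = n%:R / (n + p)%:R); first by rewrite divr_gt0// ltr0n.
  by rewrite /kappa natrD; field; rewrite -natrD gt_eqF.
have E1 : 1 - 2 * sigma ^+ 2 * (l * (1 - b) * (b * kappa)) =
    (1 - kappa) / (1 - b * kappa).
  by rewrite /l; field; rewrite ?sigma0 ?(gt_eqF bk0) ?(gt_eqF b0).
have E2 : 1 - 2 * sigma ^+ 2 * (l * (1 - b) * (b * kappa - 1)) = b^-1.
  by rewrite /l; field; rewrite ?sigma0 ?(gt_eqF bk0) ?(gt_eqF b0).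
apply: le_trans; first apply: (chernoff_excess sigma0 iX d0).
- by rewrite E1 divr_gt0.
- by rewrite E2 invr_gt0.
by rewrite E1 E2 lee_fin; exact: chernoff_value.
Qed.

Lemma iid_sub (I I' : finType) (h : I' -> I) d (T : measurableType d)
    (P : {measure set T -> \bar R}) (g : probability (measurableTypeR R) R) X :
  injective h -> iid_on g [set: I]%SET P X ->
  iid_on g [set: I']%SET P (fun i => X (h i)).
Proof.
move=> hinj iX; split=> [i|B mB]; first exact: iX.1.
pose K : {set I} := (h @: [set: I'])%SET.
have iK : iid_on g K P X by apply: iid_onS iX; exact: finset.subsetT.
pose C i := if [pick i' | h i' == i] is Some i' then B i' else setT.
have Ch i : C (h i) = B i.
  rewrite /C; case: pickP => [j /eqP/hinj -> //|/(_ i)].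
  by rewrite eqxx.
have mC i : measurable (C i) by rewrite /C; case: pickP.
have -> : [set t | forall i, i \in [set: I']%SET -> B i (X (h i) t)] =
    [set t | forall i, i \in K -> C i (X i t)].
  apply/seteqP; split=> t /= ht i.
    by move=> /imsetP[j _ ->]; rewrite Ch; apply: ht; rewrite finset.in_setT.
  by move=> _; rewrite -Ch; apply: ht; apply: imset_f; rewrite finset.in_setT.
rewrite iK.2// /K finset.big_imset /=; last by move=> i j _ _; exact: hinj.
by apply: eq_bigr => i _; rewrite Ch.
Qed.

Lemma normal_prob_set1 (x : R) : normal_prob 0 sigma [set x] = 0%E.
Proof.
have /null_content_dominatesP dom := normal_prob_dominates (0 : R) sigma.
by apply: dom => //; exact: lebesgue_measure_set1.
Qed.

Definition minor {m n k} (km : (k <= m)%N) (kn : (k <= n)%N) (A : 'M[R]_(m, n)) :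
  'M[R]_k := \matrix_(i, j) A (widen_ord km i) (widen_ord kn j).

Lemma measurable_mx_minor m n k (km : (k <= m)%N) (kn : (k <= n)%N)
    d (T : measurableType d) (A : T -> 'M[R]_(m, n)) :
  measurable_mx A -> measurable_mx (fun t => minor km kn (A t)).
Proof. by move=> mA i j; under eq_fun do rewrite mxE; exact: mA. Qed.

(** Induction on the size of the minor: expanded along its last row, the
    determinant is an affine function of its corner entry, whose slope is the
    previous minor.  If the latter does not vanish, only one value of the corner entry is
    excluded, given all the others; and normal laws have no atoms. *)
Lemma minor_det_neq0 m n k (km : (k <= m)%N) (kn : (k <= n)%N)
    d (T : measurableType d) (P : probability T R) (X : 'I_m * 'I_n -> T -> R) :
  iid_on gam [set: 'I_m * 'I_n]%SET P X ->
  P [set t | \det (minor km kn (mxof X t)) = 0] = 0%E.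
Proof.
move=> iX; elim: k km kn => [|k IH] km kn.
  rewrite (_ : [set t | _] = set0) ?measure0//.
  by apply/seteqP; split=> t //=; rewrite det_mx00 => /eqP; rewrite oner_eq0.
have km' := ltnW km; have kn' := ltnW kn.
pose im := widen_ord km (@ord_max k); pose jn := widen_ord kn (@ord_max k).
pose a := (im, jn).
pose D (A : 'M[R]_(m, n)) := \det (minor km' kn' A).
pose S (A : 'M[R]_(m, n)) := \sum_(j < k.+1 | j != ord_max)
   minor km kn A ord_max j * cofactor (minor km kn A) ord_max j.
have detE A : \det (minor km kn A) = A im jn * D A + S A.
  rewrite (expand_det_row _ ord_max) (bigD1 ord_max)//=; congr (_ + _).
  rewrite mxE /cofactor addnn -signr_odd odd_double mul1r; congr (_ * \det _).
  apply/matrixP => i j; rewrite !mxE; congr (A _ _); apply/val_inj => /=;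
    by rewrite /bump leqNgt ltn_ord.
have DS (A B : 'M[R]_(m, n)) : (forall i j, (i, j) != a -> A i j = B i j) ->
    D A = D B /\ S A = S B.
  move=> AB; split.
    congr (\det _); apply/matrixP => i j; rewrite !mxE; apply: AB.
    by rewrite xpair_eqE negb_and -val_eqE /= neq_ltn ltn_ord.
  apply: eq_bigr => j jmax; rewrite !mxE /cofactor; rewrite AB; last first.
    by rewrite xpair_eqE eqxx.
  congr (_ * _); congr (_ * _); congr (\det _).
  apply/matrixP => i l; rewrite !mxE; apply: AB.
  rewrite xpair_eqE negb_and -val_eqE /=.
  by rewrite /bump leqNgt ltn_ord /= add0n neq_ltn ltn_ord.
have mA0 : measurable_mx (fun x : cyl R ('I_m * 'I_n)%type =>
    mxof (fun i (x : cyl R ('I_m * 'I_n)%type) => x i) x).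
  by apply: measurable_mxof => i; exact: measurable_coord.
pose E : set (cyl R ('I_m * 'I_n)%type) :=
  [set x | \det (minor km kn (mxof (fun i (x : cyl R ('I_m * 'I_n)%type) => x i) x)) = 0].
have mE : measurable E.
  by apply: measurable_eq0; apply: measurable_det; exact: measurable_mx_minor.
pose X2 (i : 'I_m * 'I_n) (x : measurableTypeR R) : R := x.
have iX2 : iid_on gam (~: (~: [set a]))%SET gam X2.
  rewrite finset.setCK; split=> [i|B mB]; first exact: measurable_id.
  rewrite finset.big_set1; congr (_ _); apply/seteqP; split=> x /=.
    by apply; rewrite finset.in_set1.
  by move=> Bx i; rewrite finset.in_set1 => /eqP ->.
have iXC : iid_on gam (~: [set a])%SET P X.
  by apply: iid_onS iX; exact: finset.subsetT.
(* The corner entry [a] is moved to an independent copy. *)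
have iZ := iid_on_glue iXC iX2; set Z := glue _ _ _ in iZ.
have := iid_law iX iZ mE; rewrite /pushforward => PE.
transitivity (P (sample X @^-1` E)); first by [].
apply: (etrans PE); rewrite /product_measure1.
have ZE (t : T) (x : R) : (sample Z @^-1` E) (t, x) <->
    x * D (mxof X t) + S (mxof X t) = 0.
  rewrite /E /= detE.
  have -> : mxof (fun i (x0 : cyl R ('I_m * 'I_n)%type) => x0 i) (sample Z (t, x)) im jn = x.
    by rewrite mxE /sample /Z /glue finset.in_setC finset.in_set1 eqxx.
  set A1 := mxof _ (sample Z (t, x)).
  have [-> ->] : D A1 = D (mxof X t) /\ S A1 = S (mxof X t).
    apply: DS => i j ija; rewrite !mxE /sample /Z /glue finset.in_setC.
    by rewrite finset.in_set1 ija.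
  by [].
have mDt : measurable [set t | D (mxof X t) = 0].
  apply: measurable_eq0; apply: measurable_det; apply: measurable_mx_minor.
  exact: measurable_mxof iX.1.
have mZ : measurable (sample Z @^-1` E).
  rewrite -[X in measurable X]setTI.
  exact: (measurable_family iZ.1 measurableT mE).
apply/eqP; rewrite eq_le; apply/andP; split; last exact: integral_ge0.
apply: (@le_trans _ _ (\int[P]_t (\1_[set t | D (mxof X t) = 0] t)%:E)%E).
  apply: ge0_le_integral => //.
  - exact: measurable_fun_xsection.
  - by apply/measurable_EFinP; exact: measurable_indic.
  move=> t _; rewrite indicE /=; have [D0|Dn0] := eqVneq (D (mxof X t)) 0.
    by rewrite mem_set//= probability_le1//; exact: measurable_xsection.
  rewrite (_ : xsection _ _ = [set - S (mxof X t) / D (mxof X t)]); last first.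
    apply/seteqP; split=> x; rewrite /xsection /= inE.
      move=> /ZE /eqP; rewrite addr_eq0 => /eqP <-.
      by rewrite mulfK.
    by move=> ->; apply/ZE; rewrite divfK// addNr.
  by rewrite normal_prob_set1 lee_fin.
have PD0 : P [set t | D (mxof X t) = 0] = 0%E := IH km' kn'.
rewrite integral_indic// setIT.
by rewrite le_eqVlt; apply/orP; left; apply/eqP; exact: PD0.
Qed.

Lemma gram_det_neq0 n p d (T : measurableType d) (P : probability T R)
    (X : 'I_(n + p) * 'I_n -> T -> R) :
  iid_on gam [set: 'I_(n + p) * 'I_n]%SET P X ->
  P [set t | \det (gram (mxof X t)) = 0] = 0%E.
Proof.
move=> iX; have H := minor_det_neq0 (leq_addr p n) (leqnn n) iX.
have mA := measurable_mxof iX.1.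
apply/eqP; rewrite eq_le measure_ge0 andbT -H; apply: le_measure; rewrite ?inE.
- apply: measurable_eq0; apply: measurable_det.
  by apply: measurable_mx_mul => //; exact: measurable_mx_tr.
- by apply: measurable_eq0; apply: measurable_det; exact: measurable_mx_minor.
move=> t /= /eqP; apply: contraTeq => d0; apply: gram_unit_of_inj => v Av.
set M := minor _ _ _ in d0.
have uM : M \in unitmx by rewrite unitmxE unitfE.
suff Mv : M *m v = 0 by rewrite -(mulKmx uM v) Mv mulmx0.
apply/matrixP => i j; rewrite !mxE.
transitivity ((mxof X t *m v) (widen_ord (leq_addr p n) i) j); last first.
  by rewrite Av mxE.
rewrite mxE; apply: eq_bigr => k _; congr (_ * _).
by rewrite mxE; congr (mxof X t _ _); exact/val_inj.
Qed.

End tails.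

(** * Concentration for a fixed vector *)

Section random_matrix_tail.
Context {R : realType} (sigma : R) (sigma0 : sigma != 0).
Local Notation gam := (normal_prob 0 sigma : probability (measurableTypeR R) R).

Lemma rotation_axis m (x : 'cV[R]_m.+1) : exists2 Q, rotation Q &
  exists a : R, Q *m x = a *: delta_mx 0 0.
Proof.
have [Q rQ Qx] := rotation_QR x; exists Q => //; exists ((Q *m x) 0 0).
apply/matrixP => i j; rewrite ord1 [RHS]mxE [X in _ = _ * X]mxE eqxx andbT.
have [->|i0] := eqVneq i 0; first by rewrite mulr1.
by rewrite mulr0 Qx// lt0n.
Qed.

Lemma excessZ s c m n (A : 'M[R]_(m, n)) (a : R) x :
  excess s c A (a *: x) = a ^+ 2 * excess s c A x.
Proof. by rewrite /excess -scalemxAr !sqnZ; ring. Qed.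

Lemma excess_law m n d (T : measurableType d) (P : probability T R)
    (X Y : 'I_m * 'I_n -> T -> R) s c (x : 'cV[R]_m) :
  iid_on gam [set: 'I_m * 'I_n]%SET P X -> iid_on gam [set: 'I_m * 'I_n]%SET P Y ->
  P [set t | 0 < excess s c (mxof X t) x] = P [set t | 0 < excess s c (mxof Y t) x].
Proof.
move=> iX iY.
pose A0 (a : cyl R ('I_m * 'I_n)%type) : 'M[R]_(m, n) :=
  mxof (fun i (a : cyl R ('I_m * 'I_n)%type) => a i) a.
have mA0 : measurable_mx A0.
  by apply: measurable_mxof => i; exact: measurable_coord.
have mE : measurable [set a | 0 < excess s c (A0 a) x].
  apply: measurable_gt0; apply: measurable_excess; first exact: mA0.
  by move=> i j; exact: measurable_cst.
exact: (iid_law iX iY mE).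
Qed.

(** A rotation takes [x] to a multiple of the first basis vector.  It changes neither
    [excess] nor the law of the matrix. *)
Lemma excess_axis m n d (T : measurableType d) (P : probability T R)
    (X : 'I_m.+1 * 'I_n -> T -> R) s c (x : 'cV[R]_m.+1) :
  iid_on gam [set: 'I_m.+1 * 'I_n]%SET P X -> x != 0 ->
  P [set t | 0 < excess s c (mxof X t) x] =
  P [set t | 0 < excess s c (mxof X t) (delta_mx 0 0)].
Proof.
move=> iX x0; have [Q rQ [a Qx]] := rotation_axis x.
have QQ := rotation_orthogonal rQ.
have a0 : 0 < a ^+ 2.
  rewrite exprn_even_gt0//=; apply: contra x0 => /eqP a0.
  by rewrite -sqn_eq0 -(sqn_isometry x QQ) Qx a0 scale0r sqn_eq0.
rewrite -[RHS](excess_law s c _ (iid_rotation sigma0 rQ iX) iX).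
congr (P _); apply/seteqP; split=> t /=;
  by rewrite mxof_mulfam -(excess_rotate s c (mxof X t) x QQ) Qx excessZ (pmulr_rgt0 _ a0).
Qed.

(** By [excess_axis] the probability is the same for all nonzero vectors, hence it is
    also the probability for a random vector that is independent of the matrix and
    almost surely nonzero.  Taking this vector Gaussian and conditioning on the matrix
    instead reduces the claim to [tail_fixed_matrix]. *)
Lemma tail_fixed_vector n p d (T : measurableType d) (P : probability T R)
    (X : 'I_(n + p) * 'I_n -> T -> R) (b theta : R) (x : 'cV[R]_(n + p)) :
  (0 < n)%N -> iid_on gam [set: 'I_(n + p) * 'I_n]%SET P X -> x != 0 ->
  0 < b -> b * (p%:R / (n + p)%:R) < 1 ->
  b * expR (1 - b) <= expR (- (2 * theta)) ->
  (P [set t | (0 < excess (1 - b) (b * (p%:R / (n + p)%:R)) (mxof X t) x)%R] <=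
   (expR (- theta * p%:R))%:E)%E.
Proof.
case: n X x => // n X x _ iX x0 b0 bk1 hb.
set c := b * _; set s := 1 - b.
(* The Gaussian vector is the first column of the matrix on the second factor. *)
pose h (ij : 'I_(n.+1 + p) * 'I_1) : 'I_(n.+1 + p) * 'I_n.+1 := (ij.1, 0).
have hinj : injective h by move=> [i j] [i' j'] [->]; rewrite !ord1.
have iG := iid_sub hinj iX; set G := (fun i => X (h i)) in iG.
have iXx := @excess_axis (n + p)%N n.+1 _ _ P X s c.
rewrite (iXx x)//; set psi := P _.
pose W : set (T * T) := [set z | 0 < excess s c (mxof X z.1) (mxof G z.2)].
have mW : measurable W.
  apply: measurable_gt0; apply: measurable_excess => i j.
    have mX := measurable_mxof iX.1.
    by apply: (measurableT_comp (mX i j)); exact: measurable_fst.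
  have mG := measurable_mxof iG.1.
  by apply: (measurableT_comp (mG i j)); exact: measurable_snd.
have mG0 : measurable [set t | mxof G t 0 0 = 0].
  exact: measurable_eq0 (measurable_mxof iG.1 0 0).
have PG0 : P [set t | mxof G t 0 0 = 0] = 0%E.
  have iG0 : iid_on gam [set (0, 0) : 'I_(n.+1 + p) * 'I_1]%SET P G.
    by apply: iid_onS iG; exact: finset.subsetT.
  have := iG0.2 (fun=> [set 0]) (fun=> measurable_set1 _).
  rewrite finset.big_set1 => PGE.
  apply: etrans (normal_prob_set1 sigma 0); apply: etrans PGE.
  congr (P _); apply/seteqP; split=> t /=.
    by rewrite mxE => Gt i; rewrite finset.in_set1 => /eqP ->.
  by move=> /(_ (0, 0)); rewrite mxE finset.in_set1 eqxx; exact.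
have mD : measurable [set t | \det (gram (mxof X t)) = 0].
  apply: measurable_eq0; apply: measurable_det.
  have mX := measurable_mxof iX.1.
  by apply: measurable_mx_mul => //; exact: measurable_mx_tr.
have psifin : psi \is a fin_num.
  by apply: fin_num_measure; apply: measurable_gt0; apply: measurable_excess;
    [exact: measurable_mxof iX.1|exact: measurable_mx_cst].
have mNG : measurable (~` [set t | mxof G t 0 0 = 0]) by exact: measurableC.
have H1 : (psi <= (P \x P) W)%E.
  have -> : (P \x P)%E W = (\int[P]_t P (ysection W t))%E.
    apply: (@product_measure_unique _ _ _ _ _ P P (P \x^ P)%E) => // A B mA mB.
    by apply: etrans (product_measure2E _ _ mA mB) _.
  rewrite -[leLHS]mule1.
  have <- : P (~` [set t | mxof G t 0 0 = 0]) = 1%E.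
    by rewrite probability_setC// PG0 sube0.
  rewrite -[X in P X]setIT -integral_indic// -ge0_integralZl//; last 2 first.
  - by apply/measurable_EFinP; exact: measurable_indic.
  - by rewrite /psi measure_ge0.
  apply: ge0_le_integral => //.
  - by move=> t _; rewrite mule_ge0// /psi measure_ge0.
  - by apply: measurable_funeM; apply/measurable_EFinP; exact: measurable_indic.
  - exact: measurable_fun_ysection.
  move=> t _; rewrite indicE; case: (boolP (t \in _)) => [|_]; last first.
    by rewrite mule0.
  rewrite inE /= => Gt; rewrite mule1 /psi -(iXx (mxof G t)) //; last first.
    by apply/eqP => G0; apply: Gt; rewrite G0 mxE.
  rewrite le_eqVlt; apply/orP; left; apply/eqP; congr (P _).
  by apply/seteqP; split=> u; rewrite /ysection /= inE.
apply: (le_trans H1).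
(* [tail_fixed_matrix] covers the matrices of full rank; the others form a null set. *)
apply: (@le_trans _ _ (\int[P]_t ((expR (- theta * p%:R))%:E +
    (\1_[set t | \det (gram (mxof X t)) = 0] t)%:E))%E).
  apply: ge0_le_integral => //.
  - exact: measurable_fun_xsection.
  - by apply: emeasurable_funD => //; apply/measurable_EFinP; exact: measurable_indic.
  move=> t _; rewrite indicE; have [d0|dn0] := eqVneq (\det (gram (mxof X t))) 0.
    rewrite mem_set//=; apply: (@le_trans _ _ 1%E).
      by apply: probability_le1; exact: measurable_xsection.
    by rewrite -EFinD lee_fin lerDr expR_ge0.
  rewrite memNset; last by move=> /= /eqP; rewrite (negbTE dn0).
  rewrite adde0; apply: le_trans (tail_fixed_matrix sigma0 _ iG dn0 b0 bk1 hb) => //.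
  rewrite le_eqVlt; apply/orP; left; apply/eqP; congr (P _).
  by apply/seteqP; split=> u; rewrite /xsection /= inE.
rewrite ge0_integralD//; last by apply/measurable_EFinP; exact: measurable_indic.
rewrite integral_cst// integral_indic// setIT.
have PT : P setT = 1%E := probability_setT P.
have PD : P [set t | \det (gram (mxof X t)) = 0] = 0%E := gram_det_neq0 iX.
by rewrite le_eqVlt; apply/orP; left; apply/eqP; rewrite [X in (_ * X + _)%E]PT [X in (_ + X)%E]PD mule1 adde0.
Qed.

End random_matrix_tail.

(** * Norms, supports and blocks of sparse vectors *)

Section euclidean_norm.
Context {R : realType}.

Definition nrm {m} (x : 'cV[R]_m) : R := Num.sqrt (sqn x).

Lemma nrm_ge0 m (x : 'cV[R]_m) : 0 <= nrm x. Proof. exact: sqrtr_ge0. Qed.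

Lemma sqr_nrm m (x : 'cV[R]_m) : nrm x ^+ 2 = sqn x.
Proof. by rewrite sqr_sqrtr// sqn_ge0. Qed.

Lemma nrm_eq0 m (x : 'cV[R]_m) : (nrm x == 0) = (x == 0).
Proof. by rewrite -sqn_eq0 -sqr_nrm sqrf_eq0. Qed.

Lemma nrmZ m (a : R) (x : 'cV[R]_m) : nrm (a *: x) = `|a| * nrm x.
Proof. by rewrite /nrm sqnZ sqrtrM ?sqr_ge0// sqrtr_sqr. Qed.

Lemma nrmN m (x : 'cV[R]_m) : nrm (- x) = nrm x.
Proof. by rewrite -scaleN1r nrmZ normrN1 mul1r. Qed.

Lemma nrm_le m k (x : 'cV[R]_m) (y : 'cV[R]_k) : sqn x <= sqn y -> nrm x <= nrm y.
Proof. by move=> xy; rewrite ler_wsqrtr. Qed.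

(** Stated for arbitrary finite families, as it is also applied to absolute values. *)
Lemma cauchy_schwarz (I : finType) (u v : I -> R) :
  (\sum_i u i * v i) ^+ 2 <= (\sum_i u i ^+ 2) * (\sum_i v i ^+ 2).
Proof.
set a := \sum_i u i * v i; set U := \sum_i u i ^+ 2; set V := \sum_i v i ^+ 2.
have V0 : 0 <= V by apply: sumr_ge0 => i _; exact: sqr_ge0.
have [V00|Vn0] := eqVneq V 0.
  suff -> : a = 0 by rewrite expr0n V00 mulr0.
  rewrite /a big1// => i _; apply/eqP; rewrite mulf_eq0; apply/orP; right.
  move/eqP: V00; rewrite psumr_eq0 => [/allP/(_ i (mem_index_enum i))|j _].
    by rewrite sqrf_eq0.
  exact: sqr_ge0.
have Vp : 0 < V by rewrite lt_neqAle eq_sym Vn0.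
rewrite -subr_ge0 -(pmulr_rge0 _ Vp).
have -> : V * (U * V - a ^+ 2) = \sum_i (V * u i - a * v i) ^+ 2.
  under eq_bigr do rewrite sqrrB !exprMn.
  rewrite big_split sumrB /= -!mulr_sumr -/U -/V.
  under eq_bigr do rewrite mulrACA -mulrnAr.
  rewrite -mulr_sumr -[X in V * a * X]/(\sum_i (u i * v i) *+ 2) sumrMnl -/a.
  ring.
by apply: sumr_ge0 => i _; exact: sqr_ge0.
Qed.

Lemma nrmD m (x y : 'cV[R]_m) : nrm (x + y) <= nrm x + nrm y.
Proof.
rewrite -(@ler_pXn2r _ 2)// ?nnegrE ?addr_ge0 ?nrm_ge0// sqrrD !sqr_nrm.
have -> : sqn (x + y) = sqn x + (\sum_i x i 0 * y i 0) *+ 2 + sqn y.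
  rewrite /sqn -sumrMnl -!big_split /=; apply: eq_bigr => i _.
  by rewrite mxE sqrrD.
rewrite lerD2r lerD2l lerMn2r /=.
apply: (le_trans (ler_norm _)); rewrite -(@ler_pXn2r _ 2)// ?nnegrE//; last first.
  by rewrite mulr_ge0 ?nrm_ge0.
rewrite exprMn !sqr_nrm real_normK ?num_real//; exact: cauchy_schwarz.
Qed.

Lemma nrm_sub_le m (x y : 'cV[R]_m) : nrm x - nrm y <= nrm (x - y).
Proof. by rewrite lerBlDr (le_trans _ (nrmD _ _))// subrK. Qed.

End euclidean_norm.

Section sparsity.
Context {R : realType} {m : nat}.
Implicit Types (x v z : 'cV[R]_m) (T : {set 'I_m}).

Definition supp x : {set 'I_m} := [set i | x i 0 != 0]%SET.

Definition restr T x : 'cV[R]_m := \col_i (if i \in T then x i 0 else 0).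

Lemma restrE T x i : restr T x i 0 = if i \in T then x i 0 else 0.
Proof. by rewrite mxE. Qed.

Lemma supp_restr T x : supp (restr T x) \subset T.
Proof.
apply/fintype.subsetP => i; rewrite finset.inE restrE.
by case: ifP => //; rewrite eqxx.
Qed.

Lemma suppD x v : supp (x + v) \subset supp x :|: supp v.
Proof.
apply/fintype.subsetP => i; rewrite !finset.inE mxE; apply: contraR.
by rewrite negb_or !negbK => /andP[/eqP -> /eqP ->]; rewrite addr0.
Qed.

Lemma l1norm_ge0 x : 0 <= l1norm x.
Proof. by apply: sumr_ge0. Qed.

Lemma l1norm_eq0 x : l1norm x = 0 -> x = 0.
Proof.
move/eqP; rewrite psumr_eq0// => /allP x0; apply/matrixP => i j.
by rewrite ord1 mxE; apply/eqP; have := x0 i (mem_index_enum i); rewrite normr_eq0.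
Qed.

(** The inequality of Cauchy and Schwarz against the indicator of the support. *)
Lemma l1norm_sparse x k : (#|supp x| <= k)%N -> l1norm x <= Num.sqrt k%:R * nrm x.
Proof.
move=> xk; rewrite -(@ler_pXn2r _ 2)// ?nnegrE ?l1norm_ge0 ?mulr_ge0 ?nrm_ge0//.
rewrite exprMn sqr_nrm sqr_sqrtr//.
have -> : l1norm x = \sum_i (i \in supp x)%:R * `|x i 0|.
  apply: eq_bigr => i _; rewrite finset.inE.
  by have [->|_] := eqVneq (x i 0) 0; rewrite ?normr0 ?mulr0 ?mul1r.
apply: (le_trans (cauchy_schwarz _ _)).
under [X in _ * X <= _]eq_bigr do rewrite real_normK ?num_real//.
rewrite -/(sqn x); apply: ler_wpM2r; first exact: sqn_ge0.
rewrite (eq_bigr (fun i => if i \in supp x then 1 else 0)); last first.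
  by move=> i _; case: (i \in supp x); rewrite ?expr1n ?expr0n.
by rewrite -big_mkcond /= sumr_const ler_nat.
Qed.

Lemma top_entries x L : (L <= m)%N -> exists2 T : {set 'I_m}, #|T| = L &
  forall i j, i \in T -> j \notin T -> `|x j 0| <= `|x i 0|.
Proof.
elim: L => [|L IH] Lm.
  by exists finset.set0; [rewrite finset.cards0|move=> i j; rewrite finset.in_set0].
have [T TL Tmax] := IH (ltnW Lm).
have [i0 i0T] : exists i, i \in (~: T)%SET.
  by apply/card_gt0P; rewrite finset.cardsCs finset.setCK card_ord TL subn_gt0.
case: (@Order.TotalTheory.arg_maxP _ _ _ i0 [in (~: T)%SET] (fun i => `|x i 0|) i0T) => k kT kmax.
exists (k |: T)%SET.
  by rewrite finset.cardsU1 -finset.in_setC kT TL.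
move=> i j; rewrite !finset.in_setU1 negb_or => /orP[/eqP ->|iT] /andP[_ jT].
  by apply: kmax; rewrite /= finset.in_setC.
exact: Tmax.
Qed.

Lemma sqn_restr_le T x a : (forall i, `|x i 0| <= a) -> sqn (restr T x) <= #|T|%:R * a ^+ 2.
Proof.
move=> xa; rewrite /sqn (eq_bigr (fun i => if i \in T then x i 0 ^+ 2 else 0)); last first.
  by move=> i _; rewrite restrE; case: ifP; rewrite ?expr0n.
rewrite -big_mkcond /= mulr_natl -sumr_const; apply: ler_sum => i _.
by rewrite -real_normK ?num_real// lerXn2r ?nnegrE// (le_trans _ (xa i)).
Qed.

(** Cut [v] into blocks of [L] entries of decreasing size.  Each entry of a block is
    at most the average of the block before it, so that the Euclidean norm of a
    block is at most the l1 norm of its predecessor divided by [Num.sqrt L%:R]; and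
    [N] is controlled on blocks.  Only the first block, [T], has no
    predecessor.  The induction removes it and applies the statement to the rest. *)
Lemma block_decomposition (N : 'cV[R]_m -> R) (M : R) (L : nat) :
  (0 < L)%N -> 0 <= M -> (forall x v, N (x + v) <= N x + N v) ->
  (forall x, (#|supp x| <= L)%N -> N x <= M * nrm x) ->
  forall v, exists2 T : {set 'I_m}, (#|T| <= L)%N &
    N (v - restr T v) <= M / Num.sqrt L%:R * l1norm v.
Proof.
move=> L0 M0 ND NM v.
have sL : 0 < Num.sqrt L%:R :> R by rewrite sqrtr_gt0 ltr0n.
have [n] := ubnP #|supp v|; elim: n v => // n IH v; rewrite ltnS => vn.
have [vL|Lv] := leqP #|supp v| L.
  exists (supp v) => //.
  have -> : v - restr (supp v) v = 0.
    apply/matrixP => i j; rewrite ord1 !mxE finset.inE.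
    by have [->|_] := eqVneq (v i 0) 0; rewrite subrr.
  rewrite (@le_trans _ _ 0)//.
    rewrite (le_trans (NM 0 _))//.
      rewrite (_ : supp 0 = finset.set0) ?finset.cards0//.
      by apply/setP => i; rewrite !finset.inE mxE eqxx.
    by rewrite (_ : nrm 0 = 0) ?mulr0//; apply/eqP; rewrite nrm_eq0.
  by rewrite mulr_ge0 ?divr_ge0 ?l1norm_ge0// ltW.
have Lm : (L <= m)%N by rewrite (leq_trans (ltnW Lv))// -[leqRHS]card_ord max_card.
have [T TL Tmax] := top_entries v Lm.
exists T; first by rewrite TL.
set w := v - restr T v.
have wE i : w i 0 = if i \in T then 0 else v i 0.
  by rewrite !mxE; case: ifP; rewrite ?subrr ?subr0.
have [j0 j0v j0T] : exists2 j, j \in supp v & j \notin T.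
  apply/subsetPn; apply/negP => /finset.subset_leqif_cards/leqif_geq.
  by move/leq_of_leqif; rewrite TL leqNgt Lv.
have [i0 i0T] : exists i, i \in T by apply/card_gt0P; rewrite TL.
have vi0 : i0 \in supp v.
  move: j0v; rewrite !finset.inE -!normr_gt0 => /lt_le_trans; apply.
  exact: Tmax.
have wv : (#|supp w| < #|supp v|)%N.
  apply: proper_card; apply/properP; split.
    apply/fintype.subsetP => i; rewrite !finset.inE wE.
    by case: ifP => //; rewrite eqxx.
  by exists i0 => //; rewrite finset.inE wE i0T eqxx.
have [U UL NU] := IH w (leq_trans wv vn).
set a := \sum_(i in T) `|v i 0|.
have wa i : `|w i 0| <= a / L%:R.
  rewrite ler_pdivlMr ?ltr0n// wE; case: ifPn => iT.
    by rewrite normr0 mul0r sumr_ge0.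
  rewrite -TL mulr_natr -sumr_const; apply: ler_sum => j jT; exact: Tmax.
have a0 : 0 <= a by apply: sumr_ge0.
have l1v : l1norm v = a + l1norm w.
  rewrite /l1norm (bigID (mem T)) /=; congr (_ + _).
  rewrite [RHS](bigID (mem T)) /= [X in X + _]big1 ?add0r; last first.
    by move=> i iT; rewrite wE iT normr0.
  by apply: eq_bigr => i iT; rewrite wE (negbTE iT).
have nU : nrm (restr U w) <= a / Num.sqrt L%:R.
  rewrite -(@ler_pXn2r _ 2)// ?nnegrE ?nrm_ge0 ?divr_ge0//.
  rewrite sqr_nrm.
  apply: (le_trans (sqn_restr_le U wa)); rewrite !expr_div_n sqr_sqrtr//.
  apply: (@le_trans _ _ (L%:R * (a ^+ 2 / L%:R ^+ 2))).
    by apply: ler_wpM2r; rewrite ?ler_nat// divr_ge0 ?sqr_ge0.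
  rewrite (_ : _ * _ = a ^+ 2 / L%:R)//.
  by field; rewrite pnatr_eq0 -lt0n.
rewrite l1v mulrDr.
apply: (@le_trans _ _ (N (restr U w) + N (w - restr U w))).
  by rewrite (le_trans _ (ND _ _))// addrC subrK.
apply: lerD NU.
apply: le_trans (NM _ _) _; first by rewrite (leq_trans _ UL)// subset_leq_card// supp_restr.
by rewrite -mulrA [_ * a]mulrC ler_wpM2l.
Qed.

End sparsity.

(** * The null space property *)

Section null_space_property.
Context {R : realType}.

(** The name is that of the condition on a matrix whose null space is the range of
    [A]. *)
Definition nsp {m n} (S : nat) (A : 'M[R]_(m, n)) : Prop :=
  forall (h : 'cV[R]_n) (T : {set 'I_m}), h != 0 -> (#|T| <= S)%N ->
    l1norm (restr T (A *m h)) < l1norm (restr (~: T)%SET (A *m h)).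

Lemma l1norm_restr m (T : {set 'I_m}) (x : 'cV[R]_m) :
  l1norm (restr T x) = \sum_(i in T) `|x i 0|.
Proof.
rewrite /l1norm [RHS]big_mkcond; apply: eq_bigr => i _; rewrite restrE.
by case: ifP; rewrite ?normr0.
Qed.

Lemma l1norm_split m (T : {set 'I_m}) (x : 'cV[R]_m) :
  l1norm x = l1norm (restr T x) + l1norm (restr (~: T)%SET x).
Proof.
rewrite !l1norm_restr /l1norm (bigID (mem T)) /=; congr (_ + _).
by apply: eq_bigl => i; rewrite finset.in_setC.
Qed.

Lemma sub_restr m (T : {set 'I_m}) (x : 'cV[R]_m) :
  x - restr T x = restr (~: T)%SET x.
Proof.
apply/matrixP => i j; rewrite ord1 !mxE finset.in_setC.
by case: ifP; rewrite ?subrr ?subr0.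
Qed.

(** Moving from [f] to [f + h] removes from the objective at most the l1 mass of
    [A *m h] on the support of [e], and adds all of its mass off the support. *)
Lemma nsp_exact_recovery m n S (A : 'M[R]_(m, n)) :
  nsp S A -> exact_recovery S A.
Proof.
move=> nA f e eS; set T : {set 'I_m} := supp e.
have TS : (#|T| <= S)%N.
  by rewrite (leq_trans _ eS)// subset_leq_card//; apply/fintype.subsetP => i; rewrite !inE.
have key g : g != f -> l1norm (A *m f + e - A *m f) < l1norm (A *m f + e - A *m g).
  move=> gf; pose h := g - f.
  have h0 : h != 0 by rewrite subr_eq0.
  have -> : A *m f + e - A *m f = e by rewrite addrC addKr.
  have -> : A *m f + e - A *m g = e - A *m h.
    by rewrite /h mulmxBr opprB [A *m f + e]addrC -addrA.
  set z := A *m h; have zT := nA h T h0 TS; rewrite -/z in zT.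
  rewrite (l1norm_split T (e - z)).
  have eT i : i \notin T -> e i 0 = 0 by rewrite finset.inE negbK => /eqP.
  have -> : l1norm (restr (~: T)%SET (e - z)) = l1norm (restr (~: T)%SET z).
    rewrite !l1norm_restr; apply: eq_bigr => i; rewrite finset.in_setC => iT.
    by rewrite !mxE (eT i iT) sub0r normrN.
  apply: (@le_lt_trans _ _ (l1norm (restr T (e - z)) + l1norm (restr T z))); last first.
    by rewrite ltrD2l.
  rewrite (l1norm_split T e) [X in _ + X](_ : _ = 0) ?addr0; last first.
    by rewrite l1norm_restr big1// => i; rewrite finset.in_setC => /eT ->; rewrite normr0.
  rewrite !l1norm_restr -big_split /=; apply: ler_sum => i _.
  rewrite !mxE; apply: (le_trans _ (ler_normD _ _)).
  by rewrite subrK.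
apply/seteqP; split=> g.
  move=> /(_ f) gmin; apply/eqP; apply: contraT => gf.
  by have := key g gf; rewrite ltNge gmin.
move=> /= -> h; have [->|hf] := eqVneq h f; first by [].
exact/ltW/key.
Qed.

(** The error [restr T (A *m h)] is sparse, and [0] and [h] compete for explaining
    it, at the costs that [nsp] compares. *)
Lemma exact_recovery_nsp m n S (A : 'M[R]_(m, n)) :
  exact_recovery S A -> nsp S A.
Proof.
move=> eA h T h0 TS; set z := A *m h; set e := restr T z.
have eS : (#|[pred i | e i 0%R != 0%R]| <= S)%N.
  rewrite (leq_trans _ TS)// subset_leq_card//; apply/fintype.subsetP => i.
  rewrite inE /e restrE; case: ifP => //; by rewrite eqxx.
have E := eA 0 e eS.
have yE g : A *m 0 + e - A *m g = e - A *m g by rewrite mulmx0 add0r.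
have zE : l1norm (e - z) = l1norm (restr (~: T)%SET z).
  rewrite -opprB sub_restr /l1norm; apply: eq_bigr => i _.
  by rewrite mxE normrN.
have m0 : l1_minimizers A (A *m 0 + e) 0 by rewrite E.
rewrite lt_neqAle; apply/andP; split; last first.
  by have := m0 h; rewrite !yE mulmx0 subr0 zE.
apply/eqP => ez; have : l1_minimizers A (A *m 0 + e) h.
  move=> g; apply: le_trans (m0 g); rewrite !yE mulmx0 subr0 zE.
  by rewrite -ez.
by rewrite E /= => /eqP; rewrite (negbTE h0).
Qed.

Definition sparse {m} (k : nat) (x : 'cV[R]_m) := (#|supp x| <= k)%N.

(** If [nsp] fails for [z] in the range and [T], let [x] consist of [z] on [T] and of the
    first block, of [16 * S] entries, off [T].  The projections of [x] and of the
    remainder are opposite.  That of the remainder has norm at most [hi / 4 * nrm x]: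
    the factor [4] is [Num.sqrt (16 * S)%:R / Num.sqrt S%:R].  So [hi < 4 * lo]
    forces [x = 0]. *)
Lemma nsp_of_rip m n (S : nat) (A : 'M[R]_(m, n)) (lo hi : R) :
  (0 < S)%N -> \det (gram A) != 0 -> 0 <= hi -> hi < 4 * lo ->
  (forall x, sparse (17 * S) x -> nrm (residual A *m x) <= hi * nrm x) ->
  (forall x, sparse (17 * S) x -> lo * nrm x <= nrm (residual A *m x)) ->
  nsp S A.
Proof.
move=> S0 d0 hi0 hilo Hhi Hlo h T h0 TS; set z := A *m h.
rewrite ltNge; apply/negP => zT.
have Pz : residual A *m z = 0 by rewrite /z mulmxA residual_mul// mul0mx.
set v := restr (~: T)%SET z in zT *.
pose N x := nrm (residual A *m x).
have [U UL NU] : exists2 U : {set 'I_m}, (#|U| <= 16 * S)%N &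
    N (v - restr U v) <= hi / Num.sqrt (16 * S)%:R * l1norm v.
  apply: block_decomposition => //.
  - by rewrite muln_gt0.
  - by move=> x u; rewrite /N mulmxDr nrmD.
  - by move=> x xL; apply: Hhi; rewrite /sparse (leq_trans xL)// leq_mul2r orbT.
pose x := restr T z + restr U v.
have zx : z = x + (v - restr U v).
  by rewrite /x addrACA subrr addr0 /v -sub_restr addrC subrK.
have xS : sparse (17 * S) x.
  rewrite /sparse (leq_trans (subset_leq_card (suppD _ _)))//.
  rewrite (leq_trans (finset.leq_card_setU _ _))// (mulnDl 1 16) mul1n.
  apply: leq_add; [apply: leq_trans TS|apply: leq_trans UL];
    exact: subset_leq_card (supp_restr _ _).
have Nx : N x = N (v - restr U v).
  rewrite /N -[RHS]nrmN; congr (nrm _); apply/eqP; rewrite -subr_eq0 opprK.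
  by rewrite -mulmxDr -zx Pz.
have sS : 0 < Num.sqrt S%:R :> R by rewrite sqrtr_gt0 ltr0n.
have lT : l1norm (restr T z) <= Num.sqrt S%:R * nrm (restr T z).
  by apply: l1norm_sparse; rewrite (leq_trans (subset_leq_card (supp_restr _ _))).
have s16 : Num.sqrt (16 * S)%:R = 4 * Num.sqrt S%:R :> R.
  by rewrite natrM sqrtrM// (_ : 16%:R = 4 ^+ 2 :> R) ?sqrtr_sqr ?ger0_norm//; ring.
have Tx : nrm (restr T z) <= nrm x.
  apply: nrm_le; apply: ler_sum => i _.
  rewrite /x /v [X in _ <= X ^+ 2]mxE !restrE finset.in_setC.
  by case: (i \in T) => /=; [case: ifP; rewrite addr0|rewrite expr0n sqr_ge0].
have Nle : N x <= hi / 4 * nrm x.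
  rewrite Nx (le_trans NU)//.
  apply: (@le_trans _ _ (hi / Num.sqrt (16 * S)%:R * (Num.sqrt S%:R * nrm (restr T z)))).
    by rewrite ler_wpM2l ?divr_ge0// (le_trans zT lT).
  rewrite s16 [leLHS](_ : _ = hi / 4 * nrm (restr T z)); last first.
    by field; rewrite gt_eqF.
  by rewrite ler_wpM2l// divr_ge0.
have x0 : nrm x = 0.
  apply/eqP; rewrite eq_le nrm_ge0 andbT leNgt; apply/negP => xp.
  have := le_trans (Hlo x xS) Nle; rewrite ler_pM2r//.
  by rewrite leNgt ltr_pdivrMr// mulrC hilo.
have z0 : z = 0.
  have Tz0 : restr T z = 0.
    by apply/eqP; rewrite -nrm_eq0 eq_le nrm_ge0 andbT -x0.
  have v0 : v = 0.
    apply: l1norm_eq0; apply/eqP; rewrite eq_le l1norm_ge0 andbT.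
    rewrite (le_trans zT)// Tz0 /l1norm big1// => i _.
    by rewrite mxE normr0.
  by rewrite -(subrK (restr T z) z) sub_restr -/v v0 Tz0 addr0.
move: h0; rewrite -sqn_eq0 => /negP; apply.
have uG : gram A \in unitmx by rewrite unitmxE unitfE.
rewrite sqn_eq0; apply/eqP.
by rewrite -(mulKmx uG h) /gram -mulmxA -/z z0 !mulmx0.
Qed.

End null_space_property.

(** * A net of integer vectors *)

Section integer_net.
Context {R : realType} (m k : nat).

(* The possible values of a coordinate: [None] is [0], and [Some (s, v)] is the integer
   of absolute value [v.+1] and sign [s]. *)
Local Notation level := (option (bool * 'I_(10 * k)))%type.

Definition qval (q : level) : R :=
  if q is Some (s, v) then (-1) ^+ s * v.+1%:R else 0.

Definition qabs (q : level) : nat := if q is Some (_, v) then v.+1 else 0.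

Definition net : {set {ffun 'I_m -> level}} :=
  [set y : {ffun 'I_m -> level} | (#|[set i | y i != None]%SET| <= k)%N &&
           (\sum_i qabs (y i) <= 10 * k)%N]%SET.

Definition netpt (y : {ffun 'I_m -> level}) : 'cV[R]_m := \col_i qval (y i).

Lemma big_level (F : level -> R) :
  \sum_q F q = F None + \sum_(s : bool) \sum_(v < 10 * k) F (Some (s, v)).
Proof.
rewrite (bigD1 None)//=; congr (_ + _).
rewrite pair_bigA /= (reindex_omap Some id) /=; last by case.
apply: eq_big => [[s v]|[s v] _] //=.
by rewrite eqxx.
Qed.

Lemma geometric_le (n : nat) : \sum_(v < n) (4 / 5 : R) ^+ v.+1 <= 4.
Proof.
have -> : \sum_(v < n) (4 / 5 : R) ^+ v.+1 = 4 - 4 * (4 / 5) ^+ n.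
  elim: n => [|n IH]; first by rewrite big_ord0 expr0; ring.
  by rewrite big_ord_recr /= IH exprS; field.
by rewrite lerBlDr lerDl mulr_ge0// exprn_ge0// divr_ge0.
Qed.

(** A weighted count.  Give each coordinate the weight [(4 / 5) ^+ q] for an entry of absolute
    value [q], times [w] if the entry is nonzero.  The total weight of all vectors is at most
    [(1 + 8 * w) ^+ m], which for [w = k / (8 * m)] is at most [expR k]; and each
    vector of the net has weight at least [w ^+ k * (4 / 5) ^+ (10 * k)]. *)
Lemma card_net : (0 < k)%N -> (k <= 8 * m)%N ->
  #|net|%:R <= (expR 1 * (8 * m%:R / k%:R) * (5 / 4) ^+ 10) ^+ k :> R.
Proof.
move=> k0 km; have m0 : (0 < m)%N.
  by rewrite lt0n; apply/eqP => m0; move: km; rewrite m0 muln0 leqNgt k0.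
have k0' : 0 < k%:R :> R by rewrite ltr0n.
have m0' : 0 < m%:R :> R by rewrite ltr0n.
pose w : R := k%:R / (8 * m%:R).
have w0 : 0 < w by rewrite divr_gt0// mulr_gt0.
have w1 : w <= 1.
  by rewrite ler_pdivrMr ?mulr_gt0// mul1r -natrM ler_nat.
pose F (q : level) : R := w ^+ (q != None) * (4 / 5) ^+ qabs q.
have F0 q : 0 <= F q by rewrite mulr_ge0 ?exprn_ge0// ?divr_ge0// ltW.
have sumF : \sum_q F q <= expR (k%:R / m%:R).
  apply: le_trans (expR_ge1Dx _); rewrite big_level /F /= !expr0 mulr1 lerD2l.
  apply: (@le_trans _ _ (\sum_(s : bool) w * 4)).
    apply: ler_sum => s _; rewrite -mulr_sumr expr1; apply: (ler_wpM2l (ltW w0)).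
    exact: geometric_le.
  by rewrite big_bool /= /w le_eqVlt; apply/orP; left; apply/eqP; field; rewrite gt_eqF.
have netF y : y \in net -> w ^+ k * (4 / 5) ^+ (10 * k) <= \prod_i F (y i).
  rewrite finset.inE => /andP[ys ya]; rewrite /F big_split /=.
  apply: ler_pM.
  - by rewrite exprn_ge0// ltW.
  - by rewrite exprn_ge0// divr_ge0.
  - rewrite prodrXr; apply: (ler_wiXn2l (ltW w0) w1); rewrite (leq_trans _ ys)//.
    rewrite -sum1_card [leqRHS]big_mkcond /=; apply: leq_sum => i _.
    by rewrite finset.inE; case: (y i != None).
  - rewrite prodrXr ler_wiXn2l ?divr_ge0//.
    by lra.
have wk0 : 0 < w ^+ k * (4 / 5) ^+ (10 * k).
  by apply: mulr_gt0; [exact: exprn_gt0|apply: exprn_gt0; lra].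
rewrite -(ler_pM2r wk0).
apply: (@le_trans _ _ (\sum_(y : {ffun 'I_m -> level}) \prod_i F (y i))).
  rewrite [leLHS]mulr_natl -sumr_const [leLHS]big_mkcond /=; apply: ler_sum => y _.
  by case: ifP => [/netF //|_]; apply: prodr_ge0.
rewrite -(bigA_distr_bigA (fun=> F)) prodr_const card_ord.
apply: (@le_trans _ _ (expR (k%:R / m%:R) ^+ m)).
  by rewrite lerXn2r ?nnegrE ?expR_ge0 ?sumr_ge0.
rewrite -expRM_natr divfK ?gt_eqF// -[k%:R]mul1r expRM_natr.
rewrite exprM -!exprMn le_eqVlt; apply/orP; left; apply/eqP; congr (_ ^+ _).
by rewrite /w; field; rewrite !gt_eqF.
Qed.

(** Multiply [x] by [10 * Num.sqrt k] and round its entries towards zero.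
    The support does not grow and the norm does not increase; each of the at most [k]
    coordinates of the error is at most [(10 * Num.sqrt k)^-1].  The
    l1 norm of the rounded vector is at most [10 * k] by [l1norm_sparse]. *)
Lemma net_approx (x : 'cV[R]_m) : (0 < k)%N -> sparse k x -> nrm x <= 1 ->
  exists2 y, y \in net & exists u : 'cV[R]_m,
    let z := (10 * Num.sqrt k%:R)^-1 *: netpt y in
    [/\ nrm z <= nrm x, sparse k u, nrm u <= 1 & x = z + 10^-1 *: u].
Proof.
move=> k0 xk x1; set e := 10 * Num.sqrt k%:R.
have k1 : 1 <= k%:R :> R by rewrite ler1n.
have sk0 : 0 < Num.sqrt k%:R :> R by rewrite sqrtr_gt0 ltr0n.
have sk2 : Num.sqrt k%:R ^+ 2 = k%:R :> R by rewrite sqr_sqrtr.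
have e0 : 0 < e by rewrite mulr_gt0.
have sumx : \sum_i `|x i 0| * e <= (10 * k)%:R.
  rewrite -mulr_suml -/(l1norm x).
  apply: (@le_trans _ _ (Num.sqrt k%:R * 1 * e)).
    apply: (ler_wpM2r (ltW e0)); apply: (le_trans (l1norm_sparse xk)).
    exact: (ler_wpM2l (ltW sk0)).
  by rewrite mulr1 /e mulrCA -expr2 sk2 natrM.
pose t i := Num.truncn (`|x i 0| * e).
have tP i : (t i)%:R <= `|x i 0| * e < (t i).+1%:R.
  by apply: truncn_itv; rewrite mulr_ge0// ltW.
have sumt : (\sum_i t i <= 10 * k)%N.
  rewrite -(ler_nat R) natr_sum (le_trans _ sumx)//; apply: ler_sum => i _.
  by case/andP: (tP i).
have tk i : (t i <= 10 * k)%N by rewrite (leq_trans _ sumt)// (bigD1 i)//= leq_addr.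
pose y : {ffun 'I_m -> level} := [ffun i => if t i is v.+1 then
   omap (fun v => (x i 0 < 0, v)) (insub v : option 'I_(10 * k)) else None].
have ya i : qabs (y i) = t i.
  rewrite /y ffunE; have := tk i; case: (t i) => [//|v] vk.
  by rewrite insubT.
have yv i : qval (y i) = (-1) ^+ (x i 0 < 0)%R * (t i)%:R.
  rewrite /y ffunE; have := tk i; case: (t i) => [|v] vk; first by rewrite mulr0.
  by rewrite insubT.
have t0 i : x i 0 = 0 -> t i = 0%N.
  by move=> xi; rewrite /t xi normr0 mul0r truncn0.
have yn i : y i != None -> i \in supp x.
  rewrite finset.inE; apply: contraNneq => /t0 ti0.
  by rewrite /y ffunE ti0.
exists y.
  rewrite finset.inE; apply/andP; split.
    rewrite (leq_trans _ xk)// subset_leq_card//; apply/fintype.subsetP => i.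
    by rewrite finset.inE; exact: yn.
  by rewrite (eq_bigr t)// => i _; rewrite ya.
set z := e^-1 *: netpt y; exists (10 *: (x - z)).
have zi i : z i 0 = (-1) ^+ (x i 0 < 0)%R * ((t i)%:R / e).
  by rewrite !mxE yv mulrCA [e^-1 * _]mulrC.
have xi i : x i 0 = (-1) ^+ (x i 0 < 0)%R * `|x i 0|.
  by rewrite -realEsign ?num_real.
have te i : 0 <= (t i)%:R / e <= `|x i 0|.
  apply/andP; split; first by rewrite divr_ge0// ltW.
  by rewrite ler_pdivrMr//; case/andP: (tP i).
have uE i : (10 *: (x - z)) i 0 = 10 * (x i 0 - z i 0).
  by rewrite mxE [X in _ * X]mxE [X in _ + X]mxE.
split=> //.
- apply: nrm_le; apply: ler_sum => i _; case/andP: (te i) => te0 tex.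
  rewrite zi exprMn sqrr_sign mul1r -[in leRHS]real_normK ?num_real//.
  by rewrite lerXn2r ?nnegrE.
- rewrite /sparse (leq_trans _ xk)// subset_leq_card//.
  apply/fintype.subsetP => i; rewrite !finset.inE uE zi.
  by apply: contra => /eqP xi0; rewrite t0// xi0 mul0r mulr0 subrr mulr0.
- rewrite nrmZ ger0_norm// -ler_pdivlMl// mulr1.
  rewrite -(@ler_pXn2r _ 2)// ?nnegrE ?nrm_ge0// sqr_nrm.
  apply: (@le_trans _ _ (\sum_(i in supp x) (e^-1) ^+ 2)).
    rewrite [leRHS]big_mkcond /=; apply: ler_sum => i _; rewrite finset.inE.
    rewrite [X in X ^+ 2]mxE [X in _ + X]mxE zi.
    have [xi0|xn0] /= := eqVneq (x i 0) 0.
      by rewrite (t0 _ xi0) xi0 mul0r mulr0 subr0 expr0n.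
    rewrite [X in X - _]xi -mulrBr exprMn sqrr_sign mul1r.
    case/andP: (te i) => te0 tex; case/andP: (tP i) => _ tx.
    rewrite lerXn2r ?nnegrE ?subr_ge0 ?invr_ge0 ?(ltW e0)// lerBlDl.
    rewrite -[X in _ + X]mul1r -mulrDl.
    by rewrite ler_pdivlMr// natr1 ltW.
  rewrite sumr_const -[leLHS]mulr_natr.
  apply: (@le_trans _ _ ((e^-1) ^+ 2 * k%:R)).
    by rewrite ler_wpM2l ?sqr_ge0// ler_nat.
  by rewrite /e invfM exprMn !exprVn sk2 -mulrA mulVf ?mulr1// gt_eqF// ltr0n.
- by rewrite scalerA mulVf// scale1r addrC subrK.
Qed.

(** Let [M] be the supremum of [nrm (P *m x)] over sparse [x] of norm at most one.  The
    approximation by the net gives [M <= a + M / 10], hence the upper bound; no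
    iteration is needed, since the error is itself sparse.  For the lower bound, the
    approximant of a unit vector has norm at least [9 / 10], and the error
    costs at most [M / 10 <= a / 9]. *)
Lemma rip_of_net (P : 'M[R]_m) (a b : R) : (0 < k)%N -> 0 <= a -> 0 <= b ->
  (forall x, nrm (P *m x) <= nrm x) ->
  (forall y, y \in net -> nrm (P *m netpt y) <= a * nrm (netpt y)) ->
  (forall y, y \in net -> b * nrm (netpt y) <= nrm (P *m netpt y)) ->
  (forall x, sparse k x -> nrm (P *m x) <= 10 / 9 * a * nrm x) /\
  (forall x, sparse k x -> (9 / 10 * b - a / 9) * nrm x <= nrm (P *m x)).
Proof.
move=> k0 a0 b0 P1 Pa Pb.
pose E := [set r : R | exists2 x, sparse k x /\ nrm x <= 1 & r = nrm (P *m x)].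
have E0 : E !=set0.
  exists (nrm (P *m 0)), 0 => //; split.
    rewrite /sparse (_ : supp 0 = finset.set0) ?finset.cards0//.
    by apply/setP => i; rewrite !finset.inE mxE eqxx.
  by rewrite (_ : nrm 0 = 0)//; apply/eqP; rewrite nrm_eq0.
have Eub : has_ubound E.
  by exists 1 => _ [x [_ x1] ->]; exact: le_trans (P1 x) x1.
pose M := sup E.
have ME x : sparse k x -> nrm x <= 1 -> nrm (P *m x) <= M.
  by move=> xk x1; apply: ub_le_sup => //; exists x.
have netZ y (l : R) : y \in net -> nrm (P *m (l *: netpt y)) <= a * nrm (l *: netpt y).
  move=> yn; rewrite -scalemxAr !nrmZ mulrCA.
  by rewrite ler_wpM2l ?Pa.
have netZ' y (l : R) : y \in net -> b * nrm (l *: netpt y) <= nrm (P *m (l *: netpt y)).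
  move=> yn; rewrite -scalemxAr !nrmZ mulrCA.
  by rewrite ler_wpM2l ?Pb.
have MM : M <= 10 / 9 * a.
  suff : M <= a + 10^-1 * M by lra.
  apply: ge_sup => // _ [x [xk x1] ->].
  have [y yn [u /= [zx uk u1 xE]]] := net_approx k0 xk x1.
  rewrite [in leLHS]xE mulmxDr (le_trans (nrmD _ _))// lerD//.
    by rewrite (le_trans (netZ _ _ yn))// ler_piMr// (le_trans zx).
  by rewrite -scalemxAr nrmZ ger0_norm// ler_wpM2l// ME.
have unit (x : 'cV[R]_m) : x != 0 -> exists2 v, nrm v = 1 & x = nrm x *: v.
  move=> x0; have nx : nrm x != 0 by rewrite nrm_eq0.
  exists ((nrm x)^-1 *: x); last by rewrite scalerA divff// scale1r.
  by rewrite nrmZ normfV ger0_norm ?nrm_ge0// mulVf.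
have n00 : nrm (0 : 'cV[R]_m) = 0 by apply/eqP; rewrite nrm_eq0.
have sparse_unit (x v : 'cV[R]_m) : x != 0 -> sparse k x -> x = nrm x *: v -> sparse k v.
  move=> x0 xk xv; apply: leq_trans xk; apply: subset_leq_card.
  apply/fintype.subsetP => i; rewrite !finset.inE {1}xv mxE mulf_eq0 negb_or.
  by rewrite nrm_eq0 x0.
split=> x xk; have [->|x0] := eqVneq x 0; rewrite ?mulmx0 ?n00 ?mulr0//.
  have [v v1 xv] := unit x x0; have vk := sparse_unit x v x0 xk xv.
  rewrite {1}xv -scalemxAr nrmZ ger0_norm ?nrm_ge0// mulrC.
  rewrite ler_wpM2r ?nrm_ge0// (le_trans (ME v vk _)) ?v1//.
have [v v1 xv] := unit x x0; have vk := sparse_unit x v x0 xk xv.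
rewrite [in leRHS]xv -scalemxAr nrmZ ger0_norm ?nrm_ge0// mulrC.
rewrite ler_wpM2l ?nrm_ge0//.
have v1' : nrm v <= 1 by rewrite v1.
have [y yn [u /= [_ uk u1 vE]]] := net_approx k0 vk v1'.
set z := _ *: netpt y in vE.
have Pu : nrm (P *m (10^-1 *: u)) <= 10^-1 * M.
  by rewrite -scalemxAr nrmZ ger0_norm// ler_wpM2l// ME.
have z1 : 9 / 10 <= nrm z.
  have := nrm_sub_le v (10^-1 *: u); rewrite {2}vE addrK v1 nrmZ ger0_norm//.
  by lra.
have bz : b * (9 / 10) <= nrm (P *m z).
  by apply: le_trans (netZ' _ _ yn); rewrite ler_wpM2l.
have := nrm_sub_le (P *m z) (- (P *m (10^-1 *: u))).
by rewrite opprK nrmN -mulmxDr -vE; lra.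
Qed.

End integer_net.

(** * Measurability of the null space property *)

Section slack.
Context {R : realType}.

(** The null space property says that [slack T A h] is positive for all nonzero [h]
    and all small [T].  This is an uncountable intersection; it is
    measurable because positivity can be tested on rational vectors, once it has been made
    quantitative. *)
Definition slack {m n} (T : {set 'I_m}) (A : 'M[R]_(m, n)) (h : 'cV[R]_n) : R :=
  l1norm (restr (~: T)%SET (A *m h)) - l1norm (restr T (A *m h)).

Lemma slackE m n (T : {set 'I_m}) (A : 'M[R]_(m, n)) h :
  slack T A h = \sum_i (-1) ^+ (i \in T) * `|\sum_j A i j * h j 0|.
Proof.
rewrite /slack !l1norm_restr [RHS](bigID (mem T)) /= [LHS]addrC -sumrN; congr (_ + _).
  by apply: eq_bigr => i ->; rewrite expr1 mulN1r mxE.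
apply: eq_big => [i|i]; first by rewrite finset.in_setC.
by rewrite finset.in_setC => /negbTE ->; rewrite expr0 mul1r mxE.
Qed.

Lemma slackZ m n (T : {set 'I_m}) (A : 'M[R]_(m, n)) (a : R) h :
  slack T A (a *: h) = `|a| * slack T A h.
Proof.
rewrite !slackE mulr_sumr; apply: eq_bigr => i _; rewrite mulrCA; congr (_ * _).
rewrite -normrM mulr_sumr; congr `|_|; apply: eq_bigr => j _.
by rewrite mxE mulrCA.
Qed.

Lemma slack_lipschitz m n (T : {set 'I_m}) (A : 'M[R]_(m, n)) h u :
  slack T A h <= slack T A (h + u) + (\sum_i \sum_j `|A i j|) * l1norm u.
Proof.
rewrite !slackE mulr_suml -big_split /=; apply: ler_sum => i _.
set a := \sum_j A i j * h j 0; set b := \sum_j A i j * (h + u) j 0.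
have ab : `|b - a| <= (\sum_j `|A i j|) * l1norm u.
  rewrite /a /b -sumrB (eq_bigr (fun j => A i j * u j 0)); last first.
    by move=> j _; rewrite mxE mulrDr addrAC subrr add0r.
  apply: (le_trans (ler_norm_sum _ _ _)); rewrite mulr_suml; apply: ler_sum => j _.
  rewrite normrM ler_wpM2l// /l1norm (bigD1 j)//= lerDl; exact: sumr_ge0.
rewrite -lerBlDl; apply: le_trans ab.
have abE : a + (b - a) = b by rewrite addrC subrK.
have h1 := lerB_normD a (b - a); have h2 := ler_normD a (b - a).
rewrite abE in h1 h2.
case: (i \in T); rewrite ?expr1 ?expr0 ?mulN1r ?mul1r; lra.
Qed.

Lemma continuous_sum_ord (T : topologicalType) k (F : 'I_k -> T -> R) :
  (forall i, continuous (F i)) -> continuous (fun v => \sum_i F i v).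
Proof.
by move=> cF; apply: continuous_big => [|i _]; [exact: add_continuous|exact: cF].
Qed.

Lemma continuous_abs_form n (a : 'I_n -> R) :
  continuous (fun v : 'rV[R]_n => `|\sum_j a j * v 0 j|).
Proof.
have cS : continuous (fun v : 'rV[R]_n => \sum_j a j * v 0 j).
  apply: continuous_sum_ord => j w.
  by apply: (@continuousM _ _ (cst (a j))); [exact: cst_continuous|exact: coord_continuous].
move=> v; apply: (@continuous_comp _ _ _ _ (fun x : R => `|x|)); first exact: cS.
exact: norm_continuous.
Qed.

(** [slack T A] is continuous, absolutely homogeneous and positive on the l1 sphere,
    which is compact. *)
Lemma slack_coercive m n (T : {set 'I_m}) (A : 'M[R]_(m, n)) :
  (forall h, h != 0 -> 0 < slack T A h) ->
  exists k : nat, forall h, l1norm h <= k.+1%:R * slack T A h.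
Proof.
move=> A0.
pose f (v : 'rV[R]_n) := slack T A v^T.
have cf : continuous f.
  rewrite (_ : f = fun v => \sum_i (-1) ^+ (i \in T) * `|\sum_j A i j * v 0 j|).
    apply: continuous_sum_ord => i v.
    have ci : {for v, continuous (fun v : 'rV[R]_n => `|\sum_j A i j * v 0 j|)}.
      exact: continuous_abs_form.
    exact: (continuousM (@cst_continuous _ _ ((-1) ^+ (i \in T) : R) v) ci).
  apply/funext => v; rewrite /f slackE; apply: eq_bigr => i _.
  by congr (_ * `|_|); apply: eq_bigr => j _; rewrite mxE.
pose l (v : 'rV[R]_n) := l1norm v^T.
have cl : continuous l.
  rewrite (_ : l = fun v => \sum_i `|\sum_j (j == i)%:R * v 0 j|).
    by apply: continuous_sum_ord => i; exact: continuous_abs_form.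
  apply/funext => v; apply: eq_bigr => i _; rewrite mxE; congr `|_|.
  by rewrite (bigD1 i)//= eqxx mul1r big1 ?addr0// => j /negbTE ->; rewrite mul0r.
pose K := [set v | l v = 1].
have l1Z (a : R) h : l1norm (a *: h : 'cV[R]_n) = `|a| * l1norm h.
  by rewrite /l1norm mulr_sumr; apply: eq_bigr => i _; rewrite mxE normrM.
(* The sphere is empty in dimension zero. *)
have [K0|/set0P K0] := eqVneq K set0.
  exists 0%N => h; have [->|h0] := eqVneq h 0.
    rewrite -(scale0r (0 : 'cV[R]_n)) l1Z slackZ normr0 !mul0r mulr0//.
  have lh : l1norm h != 0 by apply: contra h0 => /eqP/l1norm_eq0 ->.
  suff : K ((l1norm h)^-1 *: h)^T by rewrite K0.
  by rewrite /K /l /= trmxK l1Z normfV ger0_norm ?l1norm_ge0// mulVf.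
have cK : compact K.
  apply: bounded_closed_compact.
    exists 1; split; first by rewrite num_real.
    move=> M M1 v Kv; apply: (le_trans _ (ltW M1)).
    rewrite -Kv /l [leLHS]/Num.norm /= mx_normrE; apply/bigmax_leP; split.
      exact: l1norm_ge0.
    move=> [i j] _ /=; rewrite /l1norm (bigD1 j)//= mxE ord1 lerDl.
    exact: sumr_ge0.
  rewrite (_ : K = l @^-1` [set 1])//; apply: closed_comp; first by move=> ? _; exact: cl.
  exact: closed_eq.
have [v vK vmin] := compact_EVT_min K0 cK (continuous_subspaceT cf).
rewrite inE in vK.
have v0 : v^T != 0.
  apply/eqP => v0; move: vK; rewrite /K /l /= v0 -(scale0r (0 : 'cV[R]_n)) l1Z.
  by rewrite normr0 mul0r => /esym/eqP; rewrite oner_eq0.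
have fv : 0 < f v by exact: A0.
exists (Num.truncn (f v)^-1) => h; have [->|h0] := eqVneq h 0.
  rewrite -(scale0r (0 : 'cV[R]_n)) l1Z slackZ normr0 !mul0r mulr0//.
have lh : l1norm h != 0 by apply: contra h0 => /eqP/l1norm_eq0 ->.
have lh0 : 0 < l1norm h by rewrite lt_neqAle eq_sym lh l1norm_ge0.
have := vmin ((l1norm h)^-1 *: h)^T; rewrite inE /K /l /f /= trmxK l1Z slackZ.
rewrite normfV ger0_norm ?l1norm_ge0// mulVf// => /(_ erefl) fh.
have fh' : f v * l1norm h <= slack T A h by rewrite -ler_pdivlMr// mulrC.
have /andP[_ tr] : (Num.truncn (f v)^-1)%:R <= (f v)^-1 < (Num.truncn (f v)^-1).+1%:R.
  by apply: truncn_itv; rewrite invr_ge0 ltW.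
apply: (@le_trans _ _ ((f v)^-1 * slack T A h)); first by rewrite ler_pdivlMl.
by rewrite ler_wpM2r ?(ltW tr)// (le_trans _ fh')// mulr_ge0// ltW.
Qed.

(** The inequality between continuous functions passes from the dense set of rational
    vectors to all [h], and the left-hand side is positive for [h != 0]. *)
Lemma slack_pos_of_rat m n (T : {set 'I_m}) (A : 'M[R]_(m, n)) k :
  (forall q : 'cV[rat]_n, l1norm (map_mx ratr q) <= k.+1%:R * slack T A (map_mx ratr q)) ->
  forall h, h != 0 -> 0 < slack T A h.
Proof.
move=> Aq h h0; have lh0 : 0 < l1norm h.
  by rewrite lt_neqAle l1norm_ge0 andbT eq_sym; apply: contra h0 => /eqP/l1norm_eq0 ->.
have k0 : 0 < k.+1%:R :> R by rewrite ltr0n.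
suff : l1norm h <= k.+1%:R * slack T A h.
  by move=> /(lt_le_trans lh0); rewrite pmulr_rgt0.
set C := \sum_i \sum_j `|A i j|.
have C0 : 0 <= C by apply: sumr_ge0 => i _; exact: sumr_ge0.
apply/ler_addgt0Pr => e e0.
(* The accuracy for which the Lipschitz bounds of both sides add up to at most [e]. *)
pose d := e / (n.+1%:R * (1 + k.+1%:R * C)).
have D0 : 0 < n.+1%:R * (1 + k.+1%:R * C) by rewrite mulr_gt0 ?ltr0n// ltr_pwDl// mulr_ge0.
have d0 : 0 < d by rewrite divr_gt0.
have /choice[q hq] : forall j, exists q : rat, `|ratr q - h j 0| <= d.
  move=> j; have : h j 0 - d < h j 0 + d by rewrite ltrD2l gtrN.
  case/rat_in_itvoo => q; rewrite in_itv /= => /andP[q1 q2]; exists q.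
  by rewrite ler_norml; apply/andP; split; lra.
pose qv : 'cV[rat]_n := \col_j q j; pose u := map_mx ratr qv - h.
have lu : l1norm u <= n%:R * d.
  rewrite [leRHS](_ : _ = \sum_(j < n) d); last by rewrite sumr_const card_ord mulr_natl.
  by apply: ler_sum => j _; rewrite /u !mxE; exact: hq.
have hqv : map_mx ratr qv = h + u by rewrite /u addrC subrK.
have lqh : l1norm h <= l1norm (h + u) + l1norm u.
  rewrite /l1norm -big_split /=; apply: ler_sum => j _; rewrite [X in `|X| + _]mxE.
  by have := ler_normB (h j 0 + u j 0) (u j 0); rewrite addrK.
have sl := slack_lipschitz T A (h + u) (- u); rewrite addrK in sl.
have lN : l1norm (- u) = l1norm u.
  by apply: eq_bigr => j _; rewrite mxE normrN.
rewrite -/C lN in sl; have := Aq qv; rewrite hqv => Ah.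
have ue : l1norm u * (1 + k.+1%:R * C) <= e.
  apply: (@le_trans _ _ (n.+1%:R * d * (1 + k.+1%:R * C))).
    rewrite ler_wpM2r ?addr_ge0 ?mulr_ge0//.
    by rewrite (le_trans lu)// ler_wpM2r ?(ltW d0)// ler_nat.
  by rewrite mulrAC mulrC /d divfK// gt_eqF.
have : k.+1%:R * slack T A (h + u) <= k.+1%:R * (slack T A h + C * l1norm u).
  by rewrite ler_wpM2l.
move: ue; nra.
Qed.

Lemma measurable_slack d (X : measurableType d) m n (T : {set 'I_m})
    (A : X -> 'M[R]_(m, n)) h :
  measurable_mx A -> measurable_fun setT (fun t => slack T (A t) h).
Proof.
move=> mA; under eq_fun do rewrite slackE.
apply: measurable_sum => i; apply: measurable_funM => //.
apply: measurableT_comp => //; apply: measurable_sum => j.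
by apply: measurable_funM => //; exact: mA.
Qed.

Lemma measurable_nsp d (X : measurableType d) m n S (A : X -> 'M[R]_(m, n)) :
  measurable_mx A -> measurable [set t | nsp S (A t)].
Proof.
move=> mA.
pose E (T : {set 'I_m}) (k : nat) (q : 'cV[rat]_n) :=
  [set t | l1norm (map_mx ratr q) <= k.+1%:R * slack T (A t) (map_mx ratr q)].
have mE T k q : measurable (E T k q).
  rewrite /E -[X in measurable X]setTI; apply: measurable_fun_le => //.
  by apply: measurable_funM => //; exact: measurable_slack.
have -> : [set t | nsp S (A t)] = \bigcap_(T in [set T : {set 'I_m} | (#|T| <= S)%N])
    \bigcup_k \bigcap_i (if unpickle i is Some q then E T k q else setT).
  apply/seteqP; split=> t /=.
    move=> nA T /= TS.
    have [k Hk] : exists k : nat, forall h, l1norm h <= k.+1%:R * slack T (A t) h.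
      by apply: slack_coercive => h h0; rewrite subr_gt0; exact: nA.
    exists k => // i _; case: unpickle => [q|//]; exact: Hk.
  move=> Et h T h0 TS; have [k _ Ek] := Et T TS.
  rewrite -subr_gt0; apply: (@slack_pos_of_rat _ _ T (A t) k) h0 => q.
  by have := Ek (pickle q) I; rewrite pickleK.
apply: fin_bigcap_measurable; first exact: finite_finset.
move=> T _; apply: bigcupT_measurable => k; apply: bigcapT_measurable => i.
by case: unpickle.
Qed.

End slack.

(** * Comparison with the threshold *)

Section threshold.
Context {R : realType}.

(** For [k = 17 * r * m] the bound of [card_net] is [(net_base / (17 * r)) ^+ k]. *)
Definition net_base : R := expR 1 * 8 * (5 / 4) ^+ 10.

Definition decay_rate (kappa r : R) : R :=
  7 / 50 * kappa - 17 * r * (ln net_base - ln (17 * r)).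

(** Compounding; for a well chosen [n] it reduces a numerical estimate of [expR] to
    rational arithmetic. *)
Lemma expR_lower (n : nat) (x : R) : (0 < n)%N -> - n%:R <= x ->
  (1 + x / n%:R) ^+ n <= expR x.
Proof.
move=> n0 nx; have n0' : 0 < n%:R :> R by rewrite ltr0n.
rewrite -[X in expR X](@divfK _ n%:R) ?gt_eqF// expRM_natr.
apply: lerXn2r; rewrite ?nnegrE ?expR_ge0 ?expR_ge1Dx//.
by rewrite -lerBlDl sub0r ler_pdivlMr// mulN1r.
Qed.

(** With [tail_rate_hi], this shows that [theta = 7 / 50] is admissible in
    [tail_fixed_vector] for [b = 2 / 5] and for [b = 2].  The quotient of these two
    bounds, [5], is what [nsp_of_rip] can accommodate after the losses of
    [rip_of_net]. *)
Lemma tail_rate_lo : 2 / 5 * expR (1 - 2 / 5) <= expR (- (2 * (7 / 50))) :> R.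
Proof.
rewrite -ler_pdivlMr ?expR_gt0// -expRB.
apply: le_trans (@expR_lower 16 _ _ _) => //; lra.
Qed.

Lemma tail_rate_hi : 2 * expR (1 - 2) <= expR (- (2 * (7 / 50))) :> R.
Proof.
rewrite -ler_pdivlMr ?expR_gt0// -expRB.
apply: le_trans (@expR_lower 16 _ _ _) => //; lra.
Qed.

Lemma net_base_gt0 : 0 < net_base.
Proof. by rewrite /net_base !mulr_gt0 ?expR_gt0// exprn_gt0// divr_gt0. Qed.

(** The form matches [ln (17 * r)], written in terms of [ln (3 * r)]. *)
Lemma ln_net_base : ln net_base <= 4 + ln 17 - ln 3.
Proof.
have -> : 4 + ln 17 - ln 3 = ln (expR 4 * 17 / 3) :> R.
  by rewrite ln_div ?posrE ?mulr_gt0 ?expR_gt0// lnM ?posrE ?expR_gt0// expRK.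
rewrite ler_ln ?posrE ?net_base_gt0 ?divr_gt0 ?mulr_gt0 ?expR_gt0//.
have e3 : (5 / 4) ^+ 12 <= expR 3 :> R.
  by apply: le_trans (@expR_lower 12 _ _ _) => //; lra.
have -> : expR 4 = expR 1 * expR 3 :> R by rewrite -expRD; congr expR; ring.
rewrite /net_base -!mulrA ler_pM2l ?expR_gt0//.
lra.
Qed.

(** The second term of the entropy is nonnegative. *)
Lemma entropy_ge (q l : R) : 0 < q -> q < 1 -> l <= - ln q -> q * l <= entropy q.
Proof.
move=> q0 q1 lq; rewrite /entropy.
have h1 : ln (1 - q) <= 0 by apply: ln_le0; lra.
have h2 : q * l <= q * (- ln q) by rewrite ler_pM2l.
by nra.
Qed.

(** A lower bound which, up to the factor [a], is the same for the three values of [j];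
    [l] is a common lower bound of the logarithms, and [a] a rational
    approximation of [Num.sqrt j%:R] from below. *)
Lemma fkappa_ge (kappa r l a : R) (j : nat) :
  0 < kappa -> 0 < r -> 0 <= l -> j%:R * r < 1 -> (0 < j)%N ->
  l <= - ln (j%:R * r) -> 0 <= a -> a ^+ 2 <= j%:R ->
  a * (Num.sqrt r / Num.sqrt kappa * (1 + Num.sqrt (2 * l))) <= fkappa kappa (j%:R * r).
Proof.
move=> k0 r0 l0 jr1 j0 lj a0 aj.
have sk : 0 < Num.sqrt kappa by rewrite sqrtr_gt0.
have j0' : 0 < j%:R :> R by rewrite ltr0n.
have jr0 : 0 < j%:R * r by rewrite mulr_gt0.
have asj : a <= Num.sqrt j%:R.
  by rewrite -[a]ger0_norm// -sqrtr_sqr ler_wsqrtr.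
have h1 : a * Num.sqrt r <= Num.sqrt (j%:R * r).
  by rewrite sqrtrM ?ler_wpM2r// ltW.
have h2 : a * Num.sqrt r * Num.sqrt (2 * l) <= Num.sqrt (2 * entropy (j%:R * r)).
  apply: (@le_trans _ _ (Num.sqrt (j%:R * r) * Num.sqrt (2 * l))).
    by rewrite ler_wpM2r.
  rewrite -sqrtrM ?(ltW jr0)// ler_wsqrtr// mulrCA ler_pM2l//.
  exact: entropy_ge.
rewrite /fkappa [leRHS]mulrC.
have -> : a * (Num.sqrt r / Num.sqrt kappa * (1 + Num.sqrt (2 * l))) =
  (a * Num.sqrt r + a * Num.sqrt r * Num.sqrt (2 * l)) / Num.sqrt kappa.
  by field; rewrite gt_eqF.
by rewrite ler_pM2r ?invr_gt0// lerD.
Qed.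

(** Let [l = - ln (3 * r)], [u = Num.sqrt (2 * l)] and [phi] the common
    part of the bounds of [fkappa_ge].  Then [rho kappa r < 1] forces
    [phi < 113 / 1000], hence [r * (1 + u) ^+ 2] is at most [13 / 1000 * kappa].
    Since [l = u ^+ 2 / 2], the claim becomes a quadratic inequality in [u], which holds
    from [u = 12 / 5] on; and [r] is so small that [u] is beyond this value. *)
Lemma decay_rate_gt0_of_rho (kappa r : R) :
  0 < kappa < 1 -> 0 < r < 1 / 3 -> rho kappa r < 1 -> 0 < decay_rate kappa r.
Proof.
move=> /andP[k0 k1] /andP[r0 r13]; rewrite /rho; do 3 rewrite big_ltn//.
rewrite big_geq// addr0 => rho1.
pose l := - ln (3 * r).
have r30 : 0 < 3 * r by rewrite mulr_gt0.
have l0 : 0 <= l by rewrite oppr_ge0 ln_le0//; lra.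
have ll (j : R) : 0 < j -> j <= 3 -> l <= - ln (j * r).
  by move=> j0 j3; rewrite lerN2 ler_ln ?posrE ?mulr_gt0// ler_pM2r.
set u := Num.sqrt (2 * l).
have u0 : 0 <= u by rewrite sqrtr_ge0.
have u2 : u ^+ 2 = 2 * l by rewrite sqr_sqrtr// mulr_ge0.
pose phi := Num.sqrt r / Num.sqrt kappa * (1 + u).
have phi0 : 0 <= phi by rewrite !mulr_ge0 ?invr_ge0 ?addr_ge0.
have phi2 : phi ^+ 2 * kappa = r * (1 + u) ^+ 2.
  rewrite /phi !exprMn exprVn !sqr_sqrtr ?ltW//.
  by field; rewrite gt_eqF.
have f1 : 1 * phi <= fkappa kappa (1%:R * r).
  by apply: fkappa_ge => //; first [lra|apply: ll; lra].
have f2 : 7 / 5 * phi <= fkappa kappa (2%:R * r).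
  by apply: fkappa_ge => //; first [lra|apply: ll; lra].
have f3 : 17 / 10 * phi <= fkappa kappa (3%:R * r).
  by apply: fkappa_ge => //; first [lra|apply: ll; lra].
have phi_lt : phi < 113 / 1000.
  rewrite ltNge; apply/negP => hphi; move: rho1; apply/negP; rewrite -leNgt.
  set F1 := fkappa _ _ in f1 *; set F2 := fkappa _ _ in f2 *.
  set F3 := fkappa _ _ in f3 *.
  (* For [phi = 113 / 1000] the sum [8.2 * phi + 5.85 * phi ^+ 2] just exceeds [1]. *)
  have g1 : 113 / 1000 <= F1 by lra.
  have g2 : 7 / 5 * (113 / 1000) <= F2 by lra.
  have g3 : 17 / 10 * (113 / 1000) <= F3 by lra.
  by nra.
have phi2_lt : r * (1 + u) ^+ 2 <= 13 / 1000 * kappa.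
  by rewrite -phi2 ler_pM2r//; nra.
have r_le : r <= 13 / 1000 by nra.
have l3 : 3 <= l.
  rewrite /l -[leLHS]opprK lerN2 -[leRHS]expRK ler_ln ?posrE ?expR_gt0//.
  apply: le_trans (@expR_lower 24 _ _ _) => //; last by lra.
  by lra.
have u24 : 12 / 5 <= u.
  by rewrite -(@ler_pXn2r _ 2)// ?nnegrE ?u2//; lra.
rewrite /decay_rate subr_gt0.
have lnE : ln (17 * r) = ln 17 - ln 3 - l.
  by rewrite /l opprK !lnM ?posrE//; ring.
have hb : ln net_base - ln (17 * r) <= l + 4.
  by have := ln_net_base; rewrite lnE; lra.
have hr : 17 * r * (ln net_base - ln (17 * r)) <= 17 * r * (l + 4).
  by apply: ler_wpM2l hb; lra.
apply: (le_lt_trans hr).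
have lE : l = u ^+ 2 / 2 by rewrite u2; lra.
have key : 17 * (13 / 1000) * (l + 4) < 7 / 50 * (1 + u) ^+ 2.
  by rewrite lE; nra.
have w0 : 0 < (1 + u) ^+ 2 by rewrite exprn_gt0//; lra.
rewrite -(ltr_pM2r w0).
have -> : 17 * r * (l + 4) * (1 + u) ^+ 2 = 17 * (l + 4) * (r * (1 + u) ^+ 2) by ring.
apply: (@le_lt_trans _ _ (17 * (l + 4) * (13 / 1000 * kappa))).
  by apply: ler_wpM2l phi2_lt; lra.
have -> : 17 * (l + 4) * (13 / 1000 * kappa) =
  17 * (13 / 1000) * (l + 4) * kappa by ring.
have -> : 7 / 50 * kappa * (1 + u) ^+ 2 = 7 / 50 * (1 + u) ^+ 2 * kappa by ring.
by rewrite ltr_pM2r.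
Qed.

(** The definition of [rstar] only concerns smaller values, but [r] is below some
    element of the set whose supremum is taken. *)
Lemma decay_rate_gt0_of_rstar (kappa r : R) :
  0 < kappa < 1 -> 0 < r < rstar kappa -> r < 1 / 3 /\ 0 < decay_rate kappa r.
Proof.
move=> hk /andP[r0 restr].
set E := [set r : R | 0 < r < 1 / 3 /\ forall r', 0 < r' < r -> rho kappa r' < 1].
have [r1 [/andP[r10 r113] hr1] rr1] : exists2 r1, E r1 & r < r1.
  apply: contrapT => H; move: restr; apply/negP; rewrite -leNgt.
  have [E0|/set0P E0] := eqVneq E set0.
    by rewrite /rstar -/E E0 sup0 ltW.
  apply: ge_sup => // x Ex; rewrite leNgt; apply/negP => rx; apply: H; by exists x.
have r13 : r < 1 / 3 by exact: lt_trans r113.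
split=> //; apply: decay_rate_gt0_of_rho => //; first by rewrite r0.
by apply: hr1; rewrite r0.
Qed.

(** With [a = net_base * expR (- 11)], the quantity [x * (ln net_base - ln x)] is
    [x * ln (a / x) + 11 * x], and [ln y <= y - 1] bounds it by [10 * x + a].  The
    exponent [11] puts [a] below [1 / 100], close to the relevant values of [x]. *)
Lemma decay_rate_gt0_of_le (kappa r x0 : R) :
  0 < r -> 17 * r <= x0 -> 10 * x0 + 1 / 100 < 7 / 50 * kappa ->
  0 < decay_rate kappa r.
Proof.
move=> r0 rx hx; rewrite /decay_rate subr_gt0; set x := 17 * r in rx *.
have x0' : 0 < x by rewrite mulr_gt0.
pose a := net_base * expR (- 11).
have a0 : 0 < a by rewrite mulr_gt0 ?net_base_gt0 ?expR_gt0.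
have ln_a : ln a = ln net_base - 11.
  by rewrite /a lnM ?posrE ?net_base_gt0 ?expR_gt0// expRK.
have a_le : a <= 1 / 100.
  have e10 : (5 / 4) ^+ 40 <= expR 10 :> R.
    by apply: le_trans (@expR_lower 40 _ _ _) => //; lra.
  have aE : a * expR 10 = 8 * (5 / 4) ^+ 10.
    rewrite /a /net_base.
    have e1 : expR (- 11) * expR 10 * expR 1 = 1 :> R.
      by rewrite -!expRD -[RHS]expR0; congr expR; ring.
    rewrite (_ : _ * expR 10 =
      8 * (5 / 4) ^+ 10 * (expR (- 11) * expR 10 * expR 1)); last by ring.
    by rewrite e1 mulr1.
  have e10' : 0 < expR 10 :> R by exact: expR_gt0.
  by rewrite -(ler_pM2r e10') aE; lra.
have tangent : x * (ln a - ln x) <= a - x.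
  rewrite -ln_div ?posrE//.
  have h : ln (1 + (a / x - 1)) <= a / x - 1.
    have ax0 : 0 < a / x by rewrite divr_gt0.
    by apply: le_ln1Dx; lra.
  rewrite addrC subrK in h.
  apply: (le_trans (ler_wpM2l (ltW x0') h)).
  by rewrite mulrBr mulr1 mulrCA divff ?mulr1// gt_eqF.
have -> : x * (ln net_base - ln x) = x * (ln a - ln x) + 11 * x.
  by rewrite ln_a; ring.
by lra.
Qed.

End threshold.

(** * The union bound *)

Section main_estimate.
Context {R : realType} (sigma : R) (sigma0 : sigma != 0).
Local Notation gam := (normal_prob 0 sigma : probability (measurableTypeR R) R).

Lemma measure_bigU_le d (T : measurableType d) (P : {measure set T -> \bar R})
    (I : Type) (s : seq I) (E : I -> set T) (b : I -> R) :
  (forall i, measurable (E i)) -> (forall i, (P (E i) <= (b i)%:E)%E) ->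
  (P (\big[setU/set0]_(i <- s) E i) <= (\sum_(i <- s) b i)%:E)%E.
Proof.
move=> mE Eb; elim: s => [|i s IH]; first by rewrite !big_nil measure0.
rewrite !big_cons EFinD; apply: le_trans (leeD (Eb i) IH).
apply: measureU2 => //.
by apply: bigsetU_measurable.
Qed.

(** [tail_fixed_vector] requires [b * kappa < 1].  Otherwise the event is almost surely
    empty, because a projection does not increase norms; and it is empty for
    [x = 0]. *)
Lemma upper_tail n p d (T : measurableType d) (P : probability T R)
    (X : 'I_(n + p) * 'I_n -> T -> R) (b theta : R) (x : 'cV[R]_(n + p)) :
  (0 < n)%N -> iid_on gam [set: 'I_(n + p) * 'I_n]%SET P X ->
  1 < b -> b * expR (1 - b) <= expR (- (2 * theta)) ->
  (P [set t | (0 < excess (1 - b) (b * (p%:R / (n + p)%:R)) (mxof X t) x)%R] <=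
   (expR (- theta * p%:R))%:E)%E.
Proof.
move=> n0 iX b1 hb; set kappa := p%:R / (n + p)%:R.
have e0 : (0 <= (expR (- theta * p%:R))%:E)%E by rewrite lee_fin expR_ge0.
have [->|x0] := eqVneq x 0.
  rewrite (_ : [set t | _] = set0) ?measure0//; apply/seteqP; split=> t //=.
  by rewrite -(scale0r (0 : 'cV[R]_(n + p))) excessZ expr0n mul0r ltxx.
have [bk1|bk1] := ltP (b * kappa) 1.
  have b0 : 0 < b by lra.
  exact: (tail_fixed_vector sigma0 n0 iX x0 b0 bk1 hb).
apply: le_trans e0; rewrite -(gram_det_neq0 iX).
have mX := measurable_mxof iX.1.
apply: le_measure; rewrite ?inE.
- by apply: measurable_gt0; apply: measurable_excess => //; exact: measurable_mx_cst.
- apply: measurable_eq0; apply: measurable_det.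
  by apply: measurable_mx_mul => //; exact: measurable_mx_tr.
move=> t /= ht; apply: contrapT => /eqP d0; move: ht; apply/negP; rewrite -leNgt.
apply: mulr_le0_ge0; first by lra.
rewrite subr_ge0; apply: (le_trans (sqn_residual_le x d0)).
exact: ler_peMl (sqn_ge0 x) bk1.
Qed.

(** The exceptional set [bad] consists of the matrices that are not of full rank and, for
    each point of the net, of the two deviation events.  Outside of it, [rip_of_net] gives
    the hypothesis of [nsp_of_rip].  There are [k = 17 * S = 17 * r * m] nonzero entries to
    place, and [p = kappa * m], so that the union bound yields the exponent
    [decay_rate]. *)
Lemma nsp_probability n p S (kappa r : R) d (T : measurableType d)
    (P : probability T R) (X : 'I_(n + p) * 'I_n -> T -> R) :
  (0 < n)%N -> 0 < kappa < 1 -> 0 < r < 1 / 3 ->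
  p%:R = kappa * (n + p)%:R -> S%:R = r * (n + p)%:R ->
  iid_on gam [set: 'I_(n + p) * 'I_n]%SET P X ->
  ((1 - 2 * expR (- decay_rate kappa r * (n + p)%:R))%:E <=
   P [set t | nsp S (mxof X t)])%E.
Proof.
move=> n0 /andP[k0 k1] /andP[r0 r13] pE SE iX.
have m0 : (0 : R) < (n + p)%:R by rewrite ltr0n addn_gt0 n0.
have kE : p%:R / (n + p)%:R = kappa by rewrite pE mulfK// gt_eqF.
have S0 : (0 < S)%N by rewrite -(ltr_nat R) SE mulr_gt0.
have mX := measurable_mxof iX.1.
set k := (17 * S)%N.
have kN0 : (0 < k)%N by rewrite muln_gt0.
have kR : k%:R = 17 * r * (n + p)%:R :> R by rewrite natrM SE; ring.
have k8 : (k <= 8 * (n + p))%N.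
  by rewrite -(ler_nat R) natrM kR; nra.
pose F := {ffun 'I_(n + p) -> option (bool * 'I_(10 * k))}.
pose lo (y : F) := [set t | 0 < excess (1 - 2 / 5) (2 / 5 * kappa) (mxof X t) (netpt y)].
pose hi (y : F) := [set t | 0 < excess (1 - 2) (2 * kappa) (mxof X t) (netpt y)].
pose D := [set t | \det (gram (mxof X t)) = 0].
have mexc s b (y : F) : measurable [set t | 0 < excess s b (mxof X t) (netpt y)].
  by apply: measurable_gt0; apply: measurable_excess => //; exact: measurable_mx_cst.
have mD : measurable D.
  apply: measurable_eq0; apply: measurable_det.
  by apply: measurable_mx_mul => //; exact: measurable_mx_tr.
have Plo y : (P (lo y) <= (expR (- (7 / 50) * p%:R))%:E)%E.
  have [y0|y0] := eqVneq (netpt y) (0 : 'cV[R]_(n + p)).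
    rewrite (_ : lo y = set0) ?measure0 ?lee_fin ?expR_ge0//.
    apply/seteqP; split=> t //=; rewrite /lo /= y0.
    by rewrite -(scale0r (0 : 'cV[R]_(n + p))) excessZ expr0n mul0r ltxx.
  have b0 : 0 < 2 / 5 :> R by lra.
  have bk : 2 / 5 * (p%:R / (n + p)%:R) < 1 :> R by rewrite kE; lra.
  have := tail_fixed_vector sigma0 n0 iX y0 b0 bk tail_rate_lo.
  by rewrite kE.
have Phi y : (P (hi y) <= (expR (- (7 / 50) * p%:R))%:E)%E.
  have b1 : 1 < 2 :> R by lra.
  by have := upper_tail (netpt y) n0 iX b1 tail_rate_hi; rewrite kE.
pose bad := D `|` \big[setU/set0]_(y <- enum (net (n + p) k)) (lo y `|` hi y).
have mLH y : measurable (lo y `|` hi y) by apply: measurableU; exact: mexc.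
have mU : measurable (\big[setU/set0]_(y <- enum (net (n + p) k)) (lo y `|` hi y)).
  exact: bigsetU_measurable.
have mbad : measurable bad by exact: measurableU.
have good : ~` bad `<=` [set t | nsp S (mxof X t)].
  move=> t /= /not_orP[/eqP d0 Ht].
  have Hy y : y \in net (n + p) k -> ~ lo y t /\ ~ hi y t.
    move=> yn; apply/not_orP => H; apply: Ht; rewrite -bigcup_seq.
    by exists y => //=; rewrite mem_enum.
  pose a : R := Num.sqrt (2 * kappa); pose b : R := Num.sqrt (2 / 5 * kappa).
  have a0 : 0 <= a by exact: sqrtr_ge0.
  have b0 : 0 <= b by exact: sqrtr_ge0.
  have a2 : a ^+ 2 = 2 * kappa by rewrite sqr_sqrtr//; lra.
  have b2 : b ^+ 2 = 2 / 5 * kappa by rewrite sqr_sqrtr//; lra.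
  have nrm_mul (e : R) (z : 'cV[R]_(n + p)) : 0 <= e ->
      Num.sqrt (e * sqn z) = Num.sqrt e * nrm z by move=> e0; rewrite sqrtrM.
  have netU y : y \in net (n + p) k ->
      nrm (residual (mxof X t) *m netpt y) <= a * nrm (netpt y).
    move=> /Hy[_ /negP]; rewrite /hi /= -leNgt /excess => h.
    by rewrite /a -nrm_mul; [apply: ler_wsqrtr; lra|lra].
  have netL y : y \in net (n + p) k ->
      b * nrm (netpt y) <= nrm (residual (mxof X t) *m netpt y).
    move=> /Hy[/negP]; rewrite /lo /= -leNgt /excess => h _.
    by rewrite /b -nrm_mul; [apply: ler_wsqrtr; lra|lra].
  have [HU HL] := rip_of_net kN0 a0 b0
    (fun x => nrm_le (sqn_residual_le x d0)) netU netL.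
  apply: (@nsp_of_rip _ _ _ _ _ (9 / 10 * b - a / 9) (10 / 9 * a)) => //.
    by rewrite mulr_ge0.
  (* This is [hi < 4 * lo]; it holds because [a / b] is the square root of [5]. *)
  have ab : a * (14 / 9) < b * (18 / 5).
    rewrite -(@ltr_pXn2r _ 2)// ?nnegrE ?mulr_ge0// !exprMn a2 b2.
    by nra.
  by lra.
have PD0 : P D = 0%E by exact: gram_det_neq0 iX.
have Pbad : (P bad <= (2 * expR (- decay_rate kappa r * (n + p)%:R))%:E)%E.
  apply: (le_trans (measureU2 _ mD mU)); rewrite [X in (X + _)%E]PD0 add0e.
  apply: (le_trans (@measure_bigU_le _ _ P _ _ _
    (fun=> 2 * expR (- (7 / 50) * p%:R)) mLH _)).
    move=> y; apply: (le_trans (measureU2 _ (mexc _ _ _) (mexc _ _ _))).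
    rewrite (_ : (2 * _)%:E = (expR (- (7 / 50) * p%:R))%:E
      + (expR (- (7 / 50) * p%:R))%:E)%E; last by rewrite -EFinD -mulr2n mulr_natl.
    exact: leeD (Plo y) (Phi y).
  rewrite lee_fin big_const_seq count_predT -cardE iter_addr addr0.
  rewrite -[leLHS]mulr_natr -mulrA ler_pM2l//.
  have r17 : 0 < 17 * r by rewrite mulr_gt0.
  have card_le : #|net (n + p) k|%:R <=
      expR (k%:R * (ln net_base - ln (17 * r))) :> R.
    apply: (le_trans (card_net kN0 k8)).
    rewrite -ln_div ?posrE ?net_base_gt0// expRM_natl.
    rewrite lnK ?posrE ?divr_gt0 ?net_base_gt0// kR /net_base.
    rewrite le_eqVlt; apply/orP; left; apply/eqP; congr (_ ^+ _).
    by field; rewrite -natrD !gt_eqF.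
  apply: (le_trans (ler_wpM2l (expR_ge0 _) card_le)).
  by rewrite -expRD ler_expR kR pE /decay_rate; lra.
have Pgood : (1 - P bad <= P [set t | nsp S (mxof X t)])%E.
  rewrite -probability_setC//; apply: le_measure => //; rewrite inE.
    exact: measurableC.
  exact: measurable_nsp.
apply: le_trans Pgood; rewrite EFinB; exact: leeB.
Qed.

End main_estimate.

(** * Exact recovery *)

Section recovery.
Context {R : realType}.

(** Recovery and [nsp] are the same event, which is measurable, and the entries
    of the matrix form an i.i.d. family in the sense of [iid_on]. *)
Lemma recovery_probability n p S (kappa r : R) d (T : measurableType d)
    (P : probability T R) (A : 'I_(n + p) * 'I_n -> {RV P >-> R}) :
  (0 < n)%N -> 0 < kappa < 1 -> 0 < r < 1 / 3 ->
  p%:R = kappa * (n + p)%:R -> S%:R = r * (n + p)%:R ->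
  iid_centered_gaussian P A ->
  with_probability_at_least P
    (1 - 2 * expR (- decay_rate kappa r * (n + p)%:R))
    [set t | exact_recovery S (random_matrix P A t)].
Proof.
move=> n0 hk hr pE SE [indep [sigma sigma0 law]].
pose X ij (t : T) : R := A ij t.
have iX : iid_on (normal_prob 0 sigma : probability (measurableTypeR R) R)
    [set: 'I_(n + p) * 'I_n]%SET P X.
  split=> [ij|B mB]; first exact: measurable_funPT.
  apply: etrans (indep [set: 'I_(n + p) * 'I_n]%SET B mB : P [set t | forall ij, ij \in [set: 'I_(n + p) * 'I_n]%SET -> B ij (X ij t)] = _) _.
  by apply: eq_bigr => ij _; exact: (law ij (B ij) (mB ij)).
have -> : [set t | exact_recovery S (random_matrix P A t)] =
    [set t | nsp S (mxof X t)].
  apply/seteqP; split=> t /=; first exact: exact_recovery_nsp.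
  exact: nsp_exact_recovery.
split; first by apply: measurable_nsp; exact: measurable_mxof iX.1.
apply: nsp_probability iX => //.
by rewrite gt_eqF.
Qed.

Lemma recovery_of_decay_rate (kappa r : R) :
  0 < kappa < 1 -> 0 < r < 1 / 3 -> 0 < decay_rate kappa r ->
  recovery_with_overwhelming_probability kappa r.
Proof.
move=> hk hr sub; exists 2, (decay_rate kappa r).
split=> // m p S m0 pE SE.
have pm : (p < m)%N.
  rewrite -(ltr_nat R) pE gtr_pMl ?ltr0n//; by case/andP: hk.
have [n mE] : exists n, m = (n + p)%N by exists (m - p)%N; rewrite subnK// ltnW.
move: pE SE pm; rewrite {}mE => pE SE pm.
rewrite addnK => /= d T P A iA.
apply: recovery_probability => //.
by rewrite -(ltn_add2r p) add0n.
Qed.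

End recovery.

Theorem corollary1p7 (R : realType) :
  (forall kappa r : R, 0 < kappa < 1 -> 0 < r < rstar kappa ->
     recovery_with_overwhelming_probability kappa r) /\
  (forall r : R, 0 < r <= 36 / 10 * 10 ^- 4 ->
     recovery_with_overwhelming_probability (3 / 4) r) /\
  (forall r : R, 0 < r <= 32 / 10 * 10 ^- 4 ->
     recovery_with_overwhelming_probability (2 / 3) r) /\
  (forall r : R, 0 < r <= 23 / 10 * 10 ^- 4 ->
     recovery_with_overwhelming_probability (1 / 2) r).
Proof.
split=> [kappa r hk hr|].
  have [r13 sub] := decay_rate_gt0_of_rstar hk hr.
  by apply: recovery_of_decay_rate => //; case/andP: hr => -> _.
have e4 : 10 ^- 4 = 1 / 10 * (1 / 10) * (1 / 10) * (1 / 10) :> R by field.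
(* In each case [x0] is [17] times the largest allowed [r]. *)
rewrite e4; split; [|split] => r /andP[r0 hr]; apply: recovery_of_decay_rate.
- lra.
- lra.
- by apply: (@decay_rate_gt0_of_le _ _ _ (612 / 1000 / 100)) => //; lra.
- lra.
- lra.
- by apply: (@decay_rate_gt0_of_le _ _ _ (544 / 1000 / 100)) => //; lra.
- lra.
- lra.
- by apply: (@decay_rate_gt0_of_le _ _ _ (391 / 1000 / 100)) => //; lra.
Qed.
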